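(* Let $S\subseteq S_n$ with $|S|\le n-1$. The following are equivalent: (1) $S$ is symmetric. (2) One of the following holds: (a) $S\subseteq\{\iota_n,\delta_n\}$; (b) $S=\{\pi_1,\dots,\pi_{n-1}\}$ where either $\mathrm{Des}(\pi_i)=\{i\}$ for all $i$, or $\mathrm{Des}(\pi_i)=[n-1]\setminus\{i\}$ for all $i$; (c) $n=4$ and $S=\{\pi_1,\pi_2\}$ or $S=\{\pi_1,\pi_2,\iota_4\}$ or $S=\{\pi_1,\pi_2,\delta_4\}$, where $\mathrm{Des}(\pi_1)=\{1,3\}$ and $\mathrm{Des}(\pi_2)=\{2\}$; (d) $n=6$ and $S=\{\pi_1,\dots,\pi_5\}$ where either $\mathrm{Des}(\pi_1)=\{1,3,5\}$, $\mathrm{Des}(\pi_2)=\{2,5\}$, $\mathrm{Des}(\pi_3)=\{3\}$, $\mathrm{Des}(\pi_4)=\{1,4\}$, $\mathrm{Des}(\pi_5)=\{2,4\}$; or $\mathrm{Des}(\pi_1)=\{2,4\}$, $\mathrm{Des}(\pi_2)=\{1,3,4\}$, $\mathrm{Des}(\pi_3)=\{1,2,4,5\}$, $\mathrm{Des}(\pi_4)=\{2,3,5\}$, $\mathrm{Des}(\pi_5)=\{1,3,5\}$. (3) $S$ is Schur-positive.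
   Context: $S_n$ is the symmetric group on $[n]$; permutations in one-line notation. $\mathrm{Des}(w)=\{i\in[n-1]: w(i)>w(i+1)\}$. For $D\subseteq[n-1]$, $F_{n,D}=\sum x_{i_1}\cdots x_{i_n}$ over $i_1\le\cdots\le i_n$ with $i_j<i_{j+1}$ whenever $j\in D$. For $S\subseteq S_n$, $Q(S)=\sum_{w\in S}F_{n,\mathrm{Des}(w)}$. $S$ is symmetric if $Q(S)$ is a symmetric function, and Schur-positive if $Q(S)$ is a symmetric function whose expansion in the Schur basis has only nonnegative coefficients. $\iota_n=12\cdots n$, $\delta_n=n\cdots 21$. *)

(* Defs.v *)
From mathcomp Require Import all_boot all_order all_algebra all_fingroup.
Set Implicit Arguments. Unset Strict Implicit. Unset Printing Implicit Defensive.
Import GRing.Theory Num.Theory.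

(* Permutations w : 'S_n act on 'I_n = {0,..,n-1}; the one-line notation of w
   is [seq val (w j) | j <- enum 'I_n] (values shifted by -1 w.r.t. the paper,
   which does not affect descents).  Descent positions are 1-based as in the paper. *)
Definition oneline n (w : 'S_n) : seq nat := [seq val (w j) | j <- enum 'I_n].

Definition Des n (w : 'S_n) : seq nat :=
  [seq i <- iota 1 n.-1 | nth 0 (oneline w) i.-1 > nth 0 (oneline w) i].

Definition iota_perm n : 'S_n := 1%g.
Definition delta_perm n : 'S_n := perm (@rev_ord_inj n).

(* Formal power series in the variables x_0, x_1, x_2, ... (indexed by nat),
   with integer coefficients: a series is given by its coefficient function on
   monomials; a monomial x_{s_1} ... x_{s_k} is represented by the sequence s
   (coefficient functions are required to only depend on s up to reordering). *)
Definition series := seq nat -> int.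

(* Coefficient of the monomial s in F_{n,D}: s corresponds to exactly one
   weakly increasing index sequence i_1 <= ... <= i_n (its sorting), and the
   coefficient is 1 iff i_j < i_{j+1} for all j in D. *)
Definition Fcoef n (D : seq nat) : series := fun s =>
  let t := sort leq s in
  Posz ((size t == n) && all (fun j => nth 0 t j.-1 < nth 0 t j) D : nat).

Definition Qfun n (S : {set 'S_n}) : series := fun s =>
  (\sum_(w in S) Fcoef n (Des w) s)%R.

Definition is_symmetric (f : series) : Prop :=
  forall sigma : nat -> nat, bijective sigma ->
    forall s, f (map sigma s) = f s.

Definition is_partition (lam : seq nat) : bool :=
  sorted geq lam && all (fun k => 0 < k) lam.

Definition is_ssyt (T : seq (seq nat)) : bool :=
  all (sorted leq) T &&
  all (fun r => all (fun c => nth 0 (nth [::] T r) c < nth 0 (nth [::] T r.+1) c)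
                    (iota 0 (size (nth [::] T r.+1))))
      (iota 0 (size T).-1).

(* coefficient of the monomial s in the Schur function s_lam: the number of
   SSYT of shape lam whose multiset of entries is that of s.  Such tableaux
   are exactly reshape lam p for p ranging over the distinct rearrangements
   of s. *)
Definition schur (lam : seq nat) : series := fun s =>
  Posz (if sumn lam == size s
   then count (fun p => is_ssyt (reshape lam p)) (undup (permutations s))
   else 0).

(* Schur-positive: symmetric, and its expansion in the Schur basis has only
   nonnegative coefficients, i.e. it is a nonnegative combination of Schur
   functions (Schur functions being a basis of the symmetric functions). *)
Definition schur_positive (f : series) : Prop :=
  is_symmetric f /\
  exists l : seq (seq nat * rat),
    all (fun lc => is_partition lc.1) l /\ all (fun lc => (0 <= lc.2)%R) l /\
    forall s, ((f s)%:~R = \sum_(lc <- l) lc.2 * (schur lc.1 s)%:~R :> rat)%R.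

(* Main.v *)
Require Import Defs.
From mathcomp Require Import all_boot all_order all_algebra all_fingroup.
From mathcomp Require Import zify.
Set Implicit Arguments. Unset Strict Implicit. Unset Printing Implicit Defensive.

(* Encode the descent set of w as a bit vector of length n - 1, and let M be the
   multiset of the vectors of the elements of S.  The monomial coefficients of
   Q(S) say that, for a list of exact bit patterns separated by free positions,
   the number of matching vectors in M only depends on the multiset of the
   patterns.  Fixing the first pattern to be a single bit and dropping it together
   with the free position after it, the vectors starting with 1 and those starting
   with 0 give two symmetric multisets in degree n - 2.  If both contain a
   non-constant vector, induction gives |S| >= 2 (n - 3), which is impossible for
   n >= 7; the cases n <= 6 are a finite check.  Otherwise, up to complementing
   all the vectors, every vector starting with 1 is constant from its third bit
   on, which by symmetry forces every non-constant vector to have its ones in two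
   adjacent positions; counting ones then leaves only {1}, ..., {n-1}.
   Conversely, (b), (c), (d) are the F-expansions of the Schur functions of shape
   (n-1,1), (2,1^(n-2)), (2,2), (3,3) and (2,2,2). *)

(** * Block patterns *)

Lemma perm_map_lift (T U : eqType) (f : T -> U) (s : seq T) (u : seq U) :
  perm_eq (map f s) u -> exists2 s', perm_eq s s' & map f s' = u.
Proof.
case: s => [|x0 s0]; first by rewrite perm_sym => /perm_nilP ->; exists [::].
set s := x0 :: s0; rewrite perm_sym => /(perm_iotaP (f x0)) [Is pI ->].
rewrite size_map in pI.
exists [seq nth x0 s i | i <- Is].
  by rewrite perm_sym; apply/(perm_iotaP x0); exists Is.
rewrite -map_comp; apply/eq_in_map => i; rewrite (perm_mem pI) mem_iota /= => hi.
by rewrite -[_ :: _]/(map f s) (nth_map x0).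
Qed.

Lemma perm_cat_mid (T : eqType) (x s1 s2 t1 t2 : seq T) :
  perm_eq (s1 ++ x ++ s2) (t1 ++ x ++ t2) = perm_eq (s1 ++ s2) (t1 ++ t2).
Proof. by rewrite perm_catCA perm_sym perm_catCA perm_cat2l perm_sym. Qed.

Lemma count_sumE (T : Type) (a : pred T) s : count a s = \sum_(x <- s) (a x : nat).
Proof. by elim: s => [|x s IH]; rewrite (big_nil, big_cons) //= IH. Qed.

(* Each block of [P] prescribes consecutive bits of [b]; the bit of [b] between two
   consecutive blocks is free. *)
Fixpoint fits (P : seq bitseq) (b : bitseq) : bool :=
  if P is p :: P' then (take (size p) b == p) && fits P' (drop (size p).+1 b)
  else true.

(* The number of bits spanned by [P], plus one. *)
Definition wt (P : seq bitseq) := sumn [seq (size p).+1 | p <- P].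

(** Symmetry of a series gives this directly only for all-zero blocks. Arbitrary blocks are allowed
    so that fixing the first block leaves a condition of the same form in lower degree. *)
Definition block_symmetric n (M : seq bitseq) :=
  forall P Q, perm_eq P Q -> wt P = n -> count (fits P) M = count (fits Q) M.

Lemma perm_wt P Q : perm_eq P Q -> wt P = wt Q.
Proof. by move=> pPQ; apply/perm_sumn/perm_map. Qed.

(** The bit left free between [p] and [q] is 1 or 0, and prescribing it merges the two blocks into
    one. The size hypothesis guarantees that [b] reaches this bit. *)
Lemma fits_split P p q P' b : (size b).+1 = wt (P ++ p :: q :: P') ->
  (fits (P ++ p :: q :: P') b : nat) =
  fits (P ++ (p ++ true :: q) :: P') b + fits (P ++ (p ++ false :: q) :: P') b.
Proof.
elim: P b => [|r P IH] b /=; last first.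
  rewrite /wt /= => hb; case: eqP => //= _; apply: IH.
  have -> : wt (P ++ p :: q :: P') = (size b).+1 - (size r).+1 by rewrite hb addKn.
  rewrite size_drop subSS subnS prednK // subn_gt0.
  have : 0 < wt (P ++ p :: q :: P') by rewrite /wt map_cat sumn_cat /= addnCA.
  rewrite /wt; lia.
rewrite /wt /= => hb.
have hp : size p < size b by lia.
have -> : b = take (size p) b ++ nth false b (size p) :: drop (size p).+1 b.
  by rewrite -drop_nth // cat_take_drop.
move: (nth false b _) (drop _ b) => x b2.
have : size (take (size p) b) = size p by rewrite size_takel // ltnW.
move: (take _ b) => b1 hb1.
have tk k : take (size p + k) (b1 ++ x :: b2) = b1 ++ take k (x :: b2).
  by rewrite take_cat hb1 ltnNge leq_addr /= addKn.
have dk k : drop (size p + k) (b1 ++ x :: b2) = drop k (x :: b2).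
  by rewrite drop_cat hb1 ltnNge leq_addr /= addKn.
have := tk 0; rewrite addn0 take0 cats0 => ->.
have := dk 1; rewrite addn1 /= drop0 => ->.
rewrite !size_cat /= -!addnS !tk !dk /= !eqseq_cat // !eqseq_cons -andbA.
by case: (b1 == p); case: x {tk dk} => //=; rewrite ?addn0.
Qed.

(* A block [p 1 q] is the difference of the two blocks [p], [q] and of the block
   [p 0 q], which lowers the number of ones. *)
Lemma block_symmetric_zero n M :
    (forall b, b \in M -> (size b).+1 = n) ->
    (forall al be, perm_eq al be -> sumn (map S al) = n ->
      count (fits [seq nseq a false | a <- al]) M =
      count (fits [seq nseq a false | a <- be]) M) ->
  block_symmetric n M.
Proof.
move=> szM symM P Q pPQ; have [k le_k] := ubnP (sumn (map (count id) P)).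
elim: k P Q pPQ le_k => // k IH P Q pPQ le_k wP.
(* Blocks without ones are determined by their lengths, and the hypothesis applies. Otherwise a
   block with a one is split there. *)
have [/hasP[b Pb b1]|] := boolP (has (has id) P); last first.
  move=> nP; have nseqE R : ~~ has (has id) R -> R = [seq nseq a false | a <- map size R].
    move=> /hasPn nR; rewrite -map_comp -{1}(map_id R); apply/eq_in_map => r /nR nr /=.
    by apply/all_pred1P; apply: contraR nr => /allPn[[]] //= rt _; apply/hasP; exists true.
  rewrite (nseqE P) // (nseqE Q) -?(perm_has _ pPQ) //.
  by apply: symM; [exact: perm_map|rewrite -map_comp].
have {b1} [p [q bE]] : exists p, exists q, b = p ++ true :: q.
  case/hasP: b1 => x bx hx; exists (take (index x b) b), (drop (index x b).+1 b).
  by case: x hx bx => // _ bx; rewrite -{2}(nth_index false bx) -drop_nth ?index_mem // cat_take_drop.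
have Qb : b \in Q by rewrite -(perm_mem pPQ).
have splitE R : b \in R -> exists R1, exists R2, R = R1 ++ b :: R2.
  by move=> Rb; case/splitPr: Rb => R1 R2; exists R1, R2.
case: (splitE _ Pb) (splitE _ Qb) => P1 [P2 PE] [Q1 [Q2 QE]].
have pR : perm_eq (P1 ++ P2) (Q1 ++ Q2).
  by rewrite -(perm_cat_mid [:: b]) -PE -QE.
have cE R1 R2 : wt (R1 ++ b :: R2) = n -> count (fits (R1 ++ p :: q :: R2)) M =
   count (fits (R1 ++ b :: R2)) M + count (fits (R1 ++ (p ++ false :: q) :: R2)) M.
  move=> wR; rewrite !count_sumE -big_split big_seq [RHS]big_seq.
  apply: eq_bigr => c Mc /=.
  rewrite bE; apply: fits_split; rewrite (szM _ Mc) -wR bE /wt !map_cat !sumn_cat /= size_cat /=.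
  lia.
have wE R1 R2 : wt (R1 ++ R2) = wt R1 + wt R2 by rewrite /wt map_cat sumn_cat.
have wQ : wt Q = n by rewrite -(perm_wt pPQ).
move: (cE P1 P2) (cE Q1 Q2); rewrite -PE -QE => /(_ wP) cP /(_ wQ) cQ.
have pi x : perm_eq (P1 ++ x ++ P2) (Q1 ++ x ++ Q2).
  by rewrite perm_cat_mid.
have lk : sumn (map (count id) P1) + sumn (map (count id) P2) + (count id p + (count id q).+1) < k.+1.
  move: le_k; rewrite PE bE map_cat sumn_cat /= count_cat /=; lia.
have e1 : count (fits (P1 ++ p :: q :: P2)) M = count (fits (Q1 ++ p :: q :: Q2)) M.
  apply: IH; [exact: (pi [:: p; q])| |].
    rewrite map_cat sumn_cat /=; lia.
  by rewrite -wP PE bE /wt !map_cat !sumn_cat /= size_cat /=; lia.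
have e2 : count (fits (P1 ++ (p ++ false :: q) :: P2)) M =
          count (fits (Q1 ++ (p ++ false :: q) :: Q2)) M.
  apply: IH; [exact: (pi [:: _])| |].
    rewrite map_cat sumn_cat /= count_cat /=; lia.
  by rewrite -wP PE bE /wt !map_cat !sumn_cat /= !size_cat /=; lia.
by move: cP cQ; rewrite e1 e2; lia.
Qed.

Lemma fits_negb P b : fits (map (map negb) P) (map negb b) = fits P b.
Proof.
elim: P b => //= p P IH b.
by rewrite size_map -map_take -map_drop IH (inj_eq (inj_map negb_inj)).
Qed.

Lemma block_symmetric_negb n M :
  block_symmetric n M -> block_symmetric n (map (map negb) M).
Proof.
move=> sM P Q pPQ wP.
have E R : count (fits R) (map (map negb) M) = count (fits (map (map negb) R)) M.
  rewrite count_map; apply: eq_count => b /=.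
  by rewrite -[RHS]fits_negb (mapK (mapK negbK)).
rewrite !E; apply: sM; first exact: perm_map.
by rewrite -wP /wt -map_comp; congr sumn; apply: eq_map => p /=; rewrite size_map.
Qed.

(** The bit after [p] is dropped too, since it is free in any pattern whose first block is [p]. *)
Definition restriction (p : bitseq) (M : seq bitseq) :=
  [seq drop (size p).+1 b | b <- M & take (size p) b == p].

Lemma block_symmetric_restriction n p M :
  block_symmetric ((size p).+1 + n) M -> block_symmetric n (restriction p M).
Proof.
move=> sM P Q pPQ wP.
have E R : count (fits R) (restriction p M) = count (fits (p :: R)) M.
  by rewrite count_map count_filter; apply: eq_count => b /=; rewrite andbC.
by rewrite !E; apply: sM; rewrite ?perm_cons // /wt /= -/(wt P) wP.
Qed.

Definition nontrivial (b : bitseq) := (true \in b) && (false \in b).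

(** On a constant vector the places of the blocks do not matter: each only has to repeat the
    constant bit. The default of [head] is harmless, because for an empty [b] the list [P] is a
    single empty block. *)
Lemma fits_trivial b P : ~~ nontrivial b -> (size b).+1 = wt P ->
  fits P b = all (all (fun x => x == head false b)) P.
Proof.
move=> tb; have {tb} : exists x, b = nseq (size b) x.
  move: tb; rewrite /nontrivial negb_and => /orP[] nb; [exists false|exists true];
  by apply/all_pred1P/allP => -[] // bx; rewrite bx in nb.
case=> x; move: (size b) => m -> {b}.
have hdE k : 0 < k -> head false (nseq k x) = x by case: k.
have nE (p : bitseq) : (nseq (size p) x == p) = all (fun y => y == x) p.
  by rewrite eq_sym; exact: sameP eqP (all_pred1P _ _).
elim: P m => //= p P IH m.
rewrite /wt /= -/(wt P) => wE.
have hp : size p <= m by lia.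
rewrite take_nseq // drop_nseq.
case: P IH wE => [|q P] IH wE.
  rewrite andbT /=; have -> : m = size p by move: wE; rewrite /wt /=; lia.
  by rewrite nE andbT; case: (p).
have m1 : 0 < m by move: wE; rewrite /wt /=; lia.
rewrite hdE //.
rewrite nE; congr (_ && _).
have wE' : (m - (size p).+1).+1 = wt (q :: P).
  move: wE; rewrite /wt /=; lia.
rewrite IH //; have [m0|m0] := posnP (m - (size p).+1); last by rewrite hdE.
have : wt (q :: P) = 1 by rewrite -wE' m0.
rewrite /wt /= => E1; have -> : q = [::] by apply/nilP; rewrite /nilp; lia.
by case: P E1 {IH wE wE'} => //= r P; lia.
Qed.

(** By [fits_trivial] the constant vectors contribute equally to both counts, so they can be
    subtracted. *)
Lemma block_symmetric_nontrivial n M : (forall b, b \in M -> (size b).+1 = n) ->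
  block_symmetric n M -> block_symmetric n (filter nontrivial M).
Proof.
move=> szM sM P Q pPQ wP; have wQ : wt Q = n by rewrite -(perm_wt pPQ).
have E R : count (fits R) M = count (fits R) (filter nontrivial M)
   + count (fits R) (filter (predC nontrivial) M).
  by rewrite -count_cat; apply/seq.permP; rewrite perm_sym; apply/permPl/perm_filterC.
move: (sM _ _ pPQ wP); rewrite !E => /eqP; rewrite (_ : count _ (filter (predC _) M) =
  count (fits Q) (filter (predC nontrivial) M)) ?eqn_add2r; first by move/eqP.
apply: eq_in_count => b; rewrite mem_filter /= => /andP[tb Mb].
by rewrite !fits_trivial ?szM //; apply: perm_all.
Qed.

(** An empty block prescribes nothing and skips one free bit, so runs of empty blocks move the other
    blocks to any position. *)
Lemma fits_nseq_nil k P b : fits (nseq k [::] ++ P) b = fits P (drop k b).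
Proof. by elim: k b => [|k IH] b; rewrite ?drop0 //= take0 eqxx IH drop_drop addn1. Qed.

Lemma take1_eq x (b : bitseq) : (take 1 b == [:: x]) = (0 < size b) && (nth false b 0 == x).
Proof. by case: b => [|y b] //=; rewrite take0 eqseq_cons andbT. Qed.

Lemma fits1 i k b : fits (nseq i [::] ++ [:: true] :: nseq k [::]) b = nth false b i.
Proof.
rewrite fits_nseq_nil /= -[nseq k _]cats0 fits_nseq_nil andbT take1_eq nth_drop addn0 size_drop subn_gt0.
by case: ltnP => [_|/(nth_default false) ->] //; case: (nth _ _ _).
Qed.

Lemma fits2 i k b :
  fits (nseq i [::] ++ [:: true; true] :: nseq k [::]) b = nth false b i && nth false b i.+1.
Proof.
rewrite fits_nseq_nil /= -[nseq k _]cats0 fits_nseq_nil andbT -[i.+1]addn1 -[i in nth _ _ i]addn0 -!nth_drop.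
by case: (drop i b) => [|[] [|[] [|? ?]]].
Qed.

(** The first [[:: true]] is followed by one free bit and then by [j] skipped ones, hence the shift
    by two. Ones at neighbouring positions need the single block of [fits2]. *)
Lemma fits11 i j k b : fits (nseq i [::] ++ [:: true] :: nseq j [::] ++ [:: true] :: nseq k [::]) b
  = nth false b i && nth false b (i + j).+2.
Proof.
rewrite fits_nseq_nil /= fits1 !nth_drop take1_eq nth_drop addn0 size_drop subn_gt0.
rewrite addnA addn2 addSn.
by case: ltnP => [_|/(nth_default false) ->] //; case: (nth _ _ _).
Qed.

Lemma wt_cat P Q : wt (P ++ Q) = wt P + wt Q.
Proof. by rewrite /wt map_cat sumn_cat. Qed.

Lemma wt_nseq k : wt (nseq k [::]) = k.
Proof. by rewrite /wt map_nseq sumn_nseq mul1n. Qed.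

Lemma wt_cons p P : wt (p :: P) = (size p).+1 + wt P.
Proof. by []. Qed.

(** The vector of the descent set [{i + 1}]: bits are indexed from 0, descents from 1. *)
Definition single m i : bitseq := [seq j == i | j <- iota 0 m].
Definition singles m := [seq single m i | i <- iota 0 m].

Lemma nth_single m i j : j < m -> nth false (single m i) j = (j == i).
Proof. by move=> jm; rewrite (nth_map 0) ?size_iota // nth_iota. Qed.

Lemma uniq_singles m : uniq (singles m).
Proof.
rewrite map_inj_in_uniq ?iota_uniq // => i j; rewrite !mem_iota !add0n => /andP[_ hi] _ E.
by apply/eqP; rewrite -(nth_single j hi) -E nth_single.
Qed.

(** As ones at distance two or more are excluded, there are at most two ones, and two ones form an
    adjacent pair. *)
Lemma sum_bits_le (b : bitseq) m : size b = m.+1 ->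
    (forall i j, i.+1 < j -> ~~ (nth false b i && nth false b j)) ->
  \sum_(0 <= i < m.+1) nth false b i
    <= 1 + \sum_(0 <= i < m) (nth false b i && nth false b i.+1).
Proof.
elim: m b => [|m IH] [|x b] // [sb] H; first by rewrite big_nat1 big_nil; case: x {H}.
rewrite big_nat_recl // [X in _ <= 1 + X]big_nat_recl //=.
case: x H => H; last by rewrite add0n; apply: IH => // i j ij; apply: (H i.+1 j.+1).
rewrite leq_add2l big_nat_recl //= big1_seq ?addn0 ?leq_addr // => i _.
by have := H 0 i.+2 isT; rewrite /= => /negbTE ->.
Qed.

(* With [A] vectors having a one at any given position and [C] having ones at any
   two given adjacent positions, counting ones gives [m A <= |M| + (m - 1) C], and
   [2 C <= A] since no vector has ones at both neighbours of a position; as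
   [|M| <= m], this leaves [A = 1] and [C = 0]. *)
Lemma singles_of_trivial_tails m M : 3 < m ->
    (forall b, b \in M -> size b = m) -> all nontrivial M ->
    block_symmetric m.+1 M -> size M <= m -> M != [::] ->
    (forall b, b \in M -> nth false b 0 -> ~~ nontrivial (drop 2 b)) ->
  perm_eq M (singles m).
Proof.
move=> m4 szM /allP ntM sM leM neM trM.
(* The permuted pattern asks for ones at positions 0, 1 and 3. The constant tail then consists of
   ones, and so does the whole vector, which is excluded. *)
have E13 : count (fits ([:: true] :: [:: true; true] :: nseq (m - 4) [::])) M = 0.
  rewrite (sM _ ([:: true; true] :: [:: true] :: nseq (m - 4) [::])); last first.
  - by rewrite !wt_cons wt_nseq /=; lia.
  - exact/permPl/(perm_catCA [:: _] [:: _]).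
  apply/eqP; rewrite -leqn0 leqNgt -has_count; apply/negP => /hasP[b Mb].
  have := ntM b Mb; have := szM b Mb; have := trM b Mb.
  case: b {Mb} => [|b0 [|b1 [|b2 [|b3 b]]]] /= + sb; try lia.
  rewrite /nontrivial !inE.
  by case: b0; case: b1; case: b2; case: b3; case: (false \in b) => //= /(_ isT).
(* A one at position 2 would make the tail constantly one, so the vector would match the pattern of
   [E13]. *)
have F02 b : b \in M -> nth false b 0 -> nth false b 2 = false.
  move=> Mb b0; apply/negP => b2; move/eqP: E13; rewrite -leqn0 leqNgt -has_count.
  case/hasP; exists b => //.
  have := szM b Mb; have := trM b Mb b0; move: b0 b2.
  case: b {Mb} => [|[] [|b1 [|[] [|b3 b]]]] //= _ _; try lia.
  rewrite take0 -[nseq _ _]cats0 fits_nseq_nil /nontrivial !inE /=.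
  by case: b3.
have neP x P i : perm_eq (nseq i [::] ++ (x : bitseq) :: nseq P [::]) (x :: nseq (i + P) [::]).
  by rewrite nseqD (perm_catCA _ [:: x]).
(* The pattern with separate single ones at [i] and [j] is a permutation of the one at 0 and 2,
   which [F02] excludes. *)
have F b : b \in M -> forall i j, i.+1 < j -> ~~ (nth false b i && nth false b j).
  move=> Mb i j ij; have [jm|mj] := ltnP j m; last first.
    by rewrite [nth false b j]nth_default ?andbF // (szM _ Mb).
  apply/negP => bij.
  have : count (fits (nseq i [::] ++ [:: true] :: nseq (j - i.+2) [::] ++
                      [:: true] :: nseq (m - j.+1) [::])) M = 0.
    rewrite (sM _ ([:: true] :: [:: true] :: nseq (m - 3) [::])).
    - apply/eqP; rewrite -leqn0 leqNgt -has_count; apply/negP => /hasP[c Mc].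
      rewrite (fits11 0 0) => /andP[c0]; have -> : (0 + 0).+2 = 2 by [].
      by rewrite F02.
    - have -> : m - 3 = i + ((j - i.+2) + (m - j.+1)) by lia.
      rewrite (perm_catCA _ [:: _]) /= perm_cons catA -nseqD.
      by rewrite (permPl (neP _ _ _)) addnA.
    - by rewrite !wt_cat !wt_cons wt_cat wt_cons !wt_nseq /=; lia.
  apply/eqP; rewrite -lt0n -has_count; apply/hasP; exists b => //.
  by rewrite fits11; have -> : (i + (j - i.+2)).+2 = j by lia.
have [A EA] : exists A, forall i, i < m -> count (fun b => nth false b i) M = A.
  exists (count (fits ([:: true] :: nseq (m - 1) [::])) M) => i im.
  rewrite -(eq_count (fits1 i (m - i.+1))); apply: sM.
    by rewrite (permPl (neP _ _ _)); have -> : i + (m - i.+1) = m - 1 by lia.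
  by rewrite wt_cat wt_cons !wt_nseq /=; lia.
have [C EC] : exists C, forall i, i.+1 < m ->
    count (fun b => nth false b i && nth false b i.+1) M = C.
  exists (count (fits ([:: true; true] :: nseq (m - 2) [::])) M) => i im.
  rewrite -(eq_count (fits2 i (m - i.+2))); apply: sM.
    by rewrite (permPl (neP _ _ _)); have -> : i + (m - i.+2) = m - 2 by lia.
  by rewrite wt_cat wt_cons !wt_nseq /=; lia.
have CA : C + C <= A.
  rewrite -{1}(EC 0) -?(EC 1) -?(EA 1) ?(ltn_trans _ m4) // !count_sumE -big_split big_seq [leqRHS]big_seq.
  apply: leq_sum => b Mb /=.
  by have := F b Mb 0 2 isT; do 3!case: (nth _ _ _).
have NA : m * A <= size M + m.-1 * C.
  case: m m4 szM sM leM trM E13 F EA EC => // m m4 szM _ _ _ _ F EA EC.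
  have -> : m.+1 * A = \sum_(b <- M) \sum_(0 <= i < m.+1) nth false b i.
    rewrite exchange_big -{1}[m.+1]subn0 -sum_nat_const_nat big_nat [RHS]big_nat.
    by apply: eq_bigr => i /andP[_ im]; rewrite -(EA i im) count_sumE.
  have -> : m.+1.-1 * C = \sum_(b <- M) \sum_(0 <= i < m) (nth false b i && nth false b i.+1).
    rewrite exchange_big -{1}[m.+1.-1]subn0 -sum_nat_const_nat big_nat [RHS]big_nat.
    by apply: eq_bigr => i /andP[_ im]; rewrite -(EC i im) count_sumE.
  rewrite -sum1_size -big_split big_seq [leqRHS]big_seq; apply: leq_sum => b Mb.
  by apply: sum_bits_le; [exact: szM|exact: F].
have A1 : A <= 1.
  by rewrite leqNgt; apply/negP => A2; nia.
have C0 : C = 0 by lia.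
have A0 : 0 < A.
  case: M neM ntM szM EA {sM leM trM E13 F02 F EC NA} => // b M _ ntM szM EA.
  have /andP[/(nthP false)[i ib bi] _] := ntM b (mem_head _ _).
  by rewrite -(EA i) ?(szM b (mem_head _ _)) //= ?bi // -(szM b (mem_head _ _)).
(* By [C = 0] and [F], a vector with a one at [i] has no other one, and [A0] provides such a vector
   for each [i]. *)
have sub : {subset singles m <= M}.
  move=> c /mapP[i]; rewrite mem_iota add0n /= => im ->.
  have : has (fun b => nth false b i) M by rewrite has_count EA.
  case/hasP => b Mb bi; suff -> : single m i = b by [].
  have nC j : j.+1 < m -> ~~ (nth false b j && nth false b j.+1).
    move=> jm; apply/negP => bj; have := EC j jm; rewrite C0 => /eqP.
    by rewrite -leqn0 leqNgt -has_count => /hasP[]; exists b.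
  apply: (@eq_from_nth _ false); rewrite size_map size_iota ?(szM b) // => j jm.
  rewrite nth_single //; have [ji|ij|->] := ltngtP j i; last by rewrite bi.
  - apply/esym/negP => bj; move: ji; rewrite leq_eqVlt => /orP[/eqP ji|ji].
      by have := nC j; rewrite ji bj bi => /(_ im).
    by have := F b Mb j i ji; rewrite bi bj.
  - apply/esym/negP => bj; move: ij; rewrite leq_eqVlt => /orP[/eqP ji|ji].
      by have := nC i; rewrite ji bj bi => /(_ jm).
    by have := F b Mb i j ji; rewrite bi bj.
(* These [m] distinct vectors exhaust [M], which has at most [m] elements. *)
have szS : size (singles m) = m by rewrite size_map size_iota.
rewrite perm_sym uniq_perm ?uniq_singles //.
  by apply: (leq_size_uniq (uniq_singles m) sub); rewrite szS.
by have [] := uniq_min_size (uniq_singles m) sub; rewrite szS.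
Qed.

(** * Classification of symmetric multisets of bit vectors *)

Definition cosingles m := map (map negb) (singles m).

Definition incr_head (al : seq nat) := if al is a :: al' then a.+1 :: al' else [:: 1].

(** The compositions of [n]: a part 1 is prepended or the first part is increased. Since [incr_head
    [::]] is [[:: 1]] again, each composition of a positive [n] appears twice, which is harmless
    because the list is only quantified over. *)
Fixpoint comps n : seq (seq nat) :=
  if n is n'.+1 then flatten [seq [:: 1 :: al; incr_head al] | al <- comps n'] else [:: [::]].

(* The blocks of a composition: [fits (zero_blocks al) b] says that the descents
   coded by [b] are among the partial sums of [al]. *)
Definition zero_blocks (al : seq nat) : seq bitseq := [seq nseq a.-1 false | a <- al].

(** A decidable form of symmetry, comparing each composition with its sorted rearrangement only. It
    is necessary for [block_symmetric] and sufficient for symmetry of the series. *)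
Definition symmetric_test n (M : seq bitseq) :=
  all (fun al => (wt (zero_blocks al) == n) ==>
    (count (fits (zero_blocks al)) M == count (fits (zero_blocks (sort geq al))) M)) (comps n).

Lemma symmetric_testT n M : block_symmetric n M -> symmetric_test n M.
Proof.
move=> sM; apply/allP => al _; apply/implyP => /eqP wal; apply/eqP/sM => //.
by rewrite perm_sym perm_map // perm_sort.
Qed.

Fixpoint seqs_of (T : Type) (s : seq T) k : seq (seq T) :=
  if k is k'.+1 then [seq x :: t | x <- s, t <- seqs_of s k'] else [:: [::]].

Lemma mem_seqs_of (T : eqType) (s t : seq T) : {subset t <= s} -> t \in seqs_of s (size t).
Proof.
elim: t => //= x t IH st; apply/allpairsPdep; exists x, t.
by split=> //; [rewrite st ?mem_head|apply: IH => y ty; rewrite st // inE ty orbT].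
Qed.

Definition multisets m k := flatten [seq seqs_of (seqs_of [:: false; true] m) j | j <- iota 0 k.+1].

Lemma mem_multisets m k M : (forall b, b \in M -> size b = m) -> size M <= k -> M \in multisets m k.
Proof.
move=> szM le; apply/flatten_mapP; exists (size M); first by rewrite mem_iota.
by apply: mem_seqs_of => b /szM <-; apply: mem_seqs_of => -[].
Qed.

(* [bits22], [bits33], [bits222]: descents of the standard Young tableaux of these
   shapes. *)
Definition bits22 : seq bitseq := [:: [:: true; false; true]; [:: false; true; false]].

Definition bits33 : seq bitseq :=
  [:: [:: true; false; true; false; true]; [:: false; true; false; false; true];
      [:: false; false; true; false; false]; [:: true; false; false; true; false];
      [:: false; true; false; true; false]].

Definition bits222 : seq bitseq :=
  [:: [:: false; true; false; true; false]; [:: true; false; true; true; false];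
      [:: true; true; false; true; true]; [:: false; true; true; false; true];
      [:: true; false; true; false; true]].

(** Constant vectors are kept here, since a restriction of a multiset of nonconstant vectors may
    contain them. *)
Definition symmetric4 : seq (seq bitseq) :=
  [:: bits22; nseq 3 false :: bits22; nseq 3 true :: bits22; singles 3; cosingles 3].

Lemma classification3 M : (forall b, b \in M -> size b = 2) -> block_symmetric 3 M ->
  size M <= 2 -> has nontrivial M -> perm_eq M (singles 2).
Proof.
move=> szM /symmetric_testT tM leM ntM; have := mem_multisets szM leM.
have : all (fun M => symmetric_test 3 M ==> has nontrivial M ==> perm_eq M (singles 2))
           (multisets 2 2) by vm_compute.
by move=> /allP H /H; rewrite tM ntM.
Qed.

Lemma classification4 M : (forall b, b \in M -> size b = 3) -> block_symmetric 4 M ->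
  size M <= 3 -> has nontrivial M -> has (perm_eq M) symmetric4.
Proof.
move=> szM /symmetric_testT tM leM ntM; have := mem_multisets szM leM.
have : all (fun M => symmetric_test 4 M ==> has nontrivial M ==> has (perm_eq M) symmetric4)
           (multisets 3 3) by vm_compute.
by move=> /allP H /H; rewrite tM ntM.
Qed.

(** Inverts a restriction to the first bit [x]: the lost second bit is guessed independently for
    each vector. *)
Fixpoint lifts x (X : seq bitseq) : seq (seq bitseq) :=
  if X is r :: X' then [seq (x :: y :: r) :: E | y <- [:: false; true], E <- lifts x X']
  else [:: [::]].

Lemma restriction_lift m x M X : (forall b, b \in M -> size b = m.+2) ->
  perm_eq (restriction [:: x] M) X ->
  exists2 E, E \in lifts x X & perm_eq [seq b <- M | take 1 b == [:: x]] E.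
Proof.
move=> szM /perm_map_lift[E pE <-]; exists E => //.
have : forall b, b \in E -> take 1 b = [:: x] /\ size b = m.+2.
  by move=> b; rewrite -(perm_mem pE) mem_filter => /andP[/eqP-> /szM].
elim: E {pE} => //= b E IH HE.
have LE : E \in lifts x (map (drop 2) E) by apply: IH => c Ec; apply: HE; rewrite inE Ec orbT.
have mf c : c :: E \in [seq c :: E0 | E0 <- lifts x (map (drop 2) E)] by exact: map_f.
have [] := HE b (mem_head _ _); case: b {HE} => [|x' [|y b]] //= [->] _.
by rewrite drop0 !mem_cat; case: y; rewrite mf ?orbT.
Qed.

Lemma perm_restrictions M : all (fun b => 0 < size b) M ->
  perm_eq M ([seq b <- M | take 1 b == [:: true]] ++ [seq b <- M | take 1 b == [:: false]]).
Proof.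
move=> szM; rewrite -(perm_filterC (fun b => take 1 b == [:: true]) M) perm_cat2l.
rewrite (@eq_in_filter _ (fun b => take 1 b == [:: false]) (predC (fun b => take 1 b == [:: true]))) //.
by move=> b /(allP szM); case: b => [|[] b] //= _; rewrite take0.
Qed.

Lemma perm_block_symmetric n M N : perm_eq M N -> block_symmetric n M -> block_symmetric n N.
Proof. by move=> /seq.permP pMN sM P Q pPQ wP; rewrite -!pMN; apply: sM. Qed.

Definition classified m M :=
  [|| perm_eq M (singles m), perm_eq M (cosingles m), (m == 3) && perm_eq M bits22
    | (m == 5) && (perm_eq M bits33 || perm_eq M bits222)].

Lemma classification m M : 1 < m -> (forall b, b \in M -> size b = m) -> all nontrivial M ->
  block_symmetric m.+1 M -> size M <= m -> M != [::] -> classified m M.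
Proof.
elim/ltn_ind: m M => m IH M m1 szM ntM sM leM neM.
have hasM : has nontrivial M by case: M ntM neM {szM sM leM} => //= b M /andP[->].
have [m3|m4] := leqP m 3.
  rewrite /classified; have [m2|m2] := eqVneq m 2.
    by subst m; rewrite (classification3 szM).
  have mE : m = 3 by lia.
  subst m; have := classification4 szM sM leM hasM; rewrite /symmetric4 /=.
  case/or4P => [->|p|p|/or3P[->|->|//]]; rewrite ?orbT //.
    by have := allP ntM (nseq 3 false); rewrite (perm_mem p) mem_head => /(_ isT).
  by have := allP ntM (nseq 3 true); rewrite (perm_mem p) mem_head => /(_ isT).
have szR x b : b \in restriction [:: x] M -> size b = m - 2.
  by case/mapP => c; rewrite mem_filter => /andP[_ /szM sc] ->; rewrite size_drop sc.
have sR x : block_symmetric (m - 2).+1 (restriction [:: x] M).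
  apply: block_symmetric_restriction; rewrite /=.
  by have -> : 2 + (m - 2).+1 = m.+1 by lia.
have trR x : ~~ has nontrivial (restriction [:: x] M) ->
    forall b, b \in M -> nth false b 0 = x -> ~~ nontrivial (drop 2 b).
  move=> /hasPn H b Mb b0; apply: H; apply/mapP; exists b => //.
  rewrite mem_filter Mb andbT; move: (szM b Mb) b0.
  by case: b {Mb} => [|y b] /=; [lia|move=> _ ->; rewrite take0].
have [htrue|/trR trE] := boolP (has nontrivial (restriction [:: true] M)); last first.
  by rewrite /classified singles_of_trivial_tails.
have [hfalse|/trR trH] := boolP (has nontrivial (restriction [:: false] M)); last first.
  (* Complementing the vectors exchanges the two restrictions, so this reduces to the previous
     case. *)
  have : perm_eq (map (map negb) M) (singles m).
    apply: singles_of_trivial_tails; rewrite ?size_map //.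
    - by move=> b /mapP[c /szM sc ->]; rewrite size_map.
    - rewrite all_map; apply: sub_all ntM => b /andP[t f] /=.
      by rewrite /nontrivial -[true]/(~~ false) -[in X in _ && X]/(~~ true) !(mem_map negb_inj) t f.
    - exact: block_symmetric_negb.
    - by case: (M) neM.
    - move=> b /mapP[c Mc ->]; rewrite (nth_map false) ?(szM c) ?(ltn_trans _ m4) //.
      move=> /negbTE /(trH _ Mc); apply: contra.
      rewrite -map_drop /nontrivial -[true]/(~~ false) -[in X in _ && X]/(~~ true).
      by rewrite !(mem_map negb_inj) andbC.
  by move=> /(perm_map (map negb)); rewrite (mapK (mapK negbK)) /classified => ->; rewrite orbT.
(* The entries of [classified] in length [m - 2] have [m - 2] vectors, except [bits22], which has
   two and occurs for [m - 2 = 3]. *)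
have lower x : has nontrivial (restriction [:: x] M) ->
    (if m == 5 then 2 else m - 2) <= size (restriction [:: x] M).
  move=> hx; set R := restriction _ _ in hx *.
  have szF : size (filter nontrivial R) <= size R by rewrite size_filter count_size.
  have [big|small] := ltnP (m - 2) (size (filter nontrivial R)).
    by apply: leq_trans szF; case: ifP => _; lia.
  apply: leq_trans szF; have : classified (m - 2) (filter nontrivial R).
    apply: IH; rewrite ?filter_all ?(negPn _) //; try lia.
    - by move=> b; rewrite mem_filter => /andP[_ /(szR x)].
    - by apply: block_symmetric_nontrivial; [by move=> b /(szR x) ->|exact: sR].
    - by rewrite -size_eq0 size_filter -lt0n -has_count.
  case/or4P => [/perm_size ->|/perm_size ->|/andP[/eqP m3 /perm_size ->]|
     /andP[/eqP m5 /orP[]/perm_size ->]]; rewrite ?size_map ?size_iota /=; case: ifP => /eqP; lia.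
have pM : perm_eq M ([seq b <- M | take 1 b == [:: true]] ++ [seq b <- M | take 1 b == [:: false]]).
  by apply: perm_restrictions; apply/allP => b /szM ->; lia.
have szE : size M = size (restriction [:: true] M) + size (restriction [:: false] M).
  by rewrite (perm_size pM) size_cat !size_map.
have := lower _ htrue; have := lower _ hfalse; have [m5|m5] := eqVneq m 5 => leF leT.
  subst m.
  (* Each side has at least two of the at most five vectors, hence at most three, and is listed by
     [classification4]. All ways to put the lost bits back are then tested. *)
  have /hasP[X X4 pX] : has (perm_eq (restriction [:: true] M)) symmetric4.
    apply: classification4 (szR true) (sR true) _ htrue.
    by rewrite -(leq_add2r 2) (leq_trans _ leM) // szE leq_add2l.
  have /hasP[Y Y4 pY] : has (perm_eq (restriction [:: false] M)) symmetric4.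
    apply: classification4 (szR false) (sR false) _ hfalse.
    by rewrite -(leq_add2l 2) (leq_trans _ leM) // szE leq_add2r.
  have [E LE pE] := restriction_lift szM pX.
  have [F LF pF] := restriction_lift szM pY.
  have pEF : perm_eq M (E ++ F) by rewrite (permPl pM) perm_cat.
  have tEF := symmetric_testT (perm_block_symmetric pEF sM).
  have leXY : size X + size Y <= 5 by rewrite -(perm_size pX) -(perm_size pY) -szE.
  rewrite /classified !(permPl pEF) /=.
  have : all (fun X => all (fun Y => (size X + size Y <= 5) ==>
      all (fun E => all (fun F => symmetric_test 6 (E ++ F) ==>
        (perm_eq (E ++ F) bits33 || perm_eq (E ++ F) bits222)) (lifts false Y)) (lifts true X))
    symmetric4) symmetric4 by vm_compute.
  move=> /allP/(_ X X4)/allP/(_ Y Y4); rewrite leXY => /allP/(_ E LE)/allP/(_ F LF).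
  by move=> /implyP/(_ tEF) ->; rewrite !orbT.
(* Here [2 (m - 2) <= m], and each side has exactly two vectors. No lift of the two sides passes the
   symmetry test, so this case is void. *)
have mE : m = 4 by lia.
subst m.
have pX : perm_eq (restriction [:: true] M) (singles 2).
  apply: classification3 (szR true) (sR true) _ htrue.
    by rewrite -(leq_add2r 2) (leq_trans _ leM) // szE leq_add2l.
have pY : perm_eq (restriction [:: false] M) (singles 2).
  apply: classification3 (szR false) (sR false) _ hfalse.
    by rewrite -(leq_add2l 2) (leq_trans _ leM) // szE leq_add2r.
have [E LE pE] := restriction_lift szM pX.
have [F LF pF] := restriction_lift szM pY.
have pEF : perm_eq M (E ++ F) by rewrite (permPl pM) perm_cat.
have tEF := symmetric_testT (perm_block_symmetric pEF sM).
have : all (fun E => all (fun F => ~~ symmetric_test 5 (E ++ F)) (lifts false (singles 2)))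
  (lifts true (singles 2)) by vm_compute.
by move=> /allP/(_ E LE)/allP/(_ F LF); rewrite tEF.
Qed.

(** * Descents and monomials *)

Definition asc (t : seq nat) : bitseq := if t is x :: t' then pairmap ltn x t' else [::].

(** Inclusion of the coded sets; against [asc] it says that every descent sits at a strict increase
    of the indices. *)
Definition below (b c : bitseq) := all2 implb b c.

Lemma size_asc t : size (asc t) = (size t).-1.
Proof. by case: t => //= x t; rewrite size_pairmap. Qed.

Lemma asc_cat x s y t : asc ((x :: s) ++ y :: t) = asc (x :: s) ++ (last x s < y) :: asc (y :: t).
Proof. by rewrite /= pairmap_cat. Qed.

Lemma ascE t : asc t = [seq nth 0 t j.-1 < nth 0 t j | j <- iota 1 (size t).-1].
Proof.
apply: (@eq_from_nth _ false); rewrite size_asc ?size_map ?size_iota // => i.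
case: t => //= x t it; rewrite (nth_map 0) ?size_iota // nth_iota //.
by rewrite (nth_pairmap 0).
Qed.

Lemma all_mask (T : Type) (a : pred T) b s : size b = size s ->
  all a (mask b s) = below b (map a s).
Proof.
elim: s b => [|x s IH] [|y b] //= [sb].
by case: y => /=; rewrite IH.
Qed.

Definition decode n (b : bitseq) := mask b (iota 1 n.-1).

Lemma FcoefE n b s : size b = n.-1 ->
  Fcoef n (decode n b) s = Posz ((size s == n) && below b (asc (sort leq s))).
Proof.
move=> sb; rewrite /Fcoef size_sort; case: eqP => //= sn.
by rewrite all_mask ?size_iota // ascE size_sort sn.
Qed.

Definition Des_bits n (w : 'S_n) : bitseq :=
  [seq nth 0 (oneline w) i.-1 > nth 0 (oneline w) i | i <- iota 1 n.-1].

Lemma size_Des_bits n (w : 'S_n) : size (Des_bits w) = n.-1.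
Proof. by rewrite size_map size_iota. Qed.

Lemma DesE n (w : 'S_n) : Des w = decode n (Des_bits w).
Proof. exact: filter_mask. Qed.

Definition descents n (S : {set 'S_n}) := [seq Des_bits w | w <- enum S].

Lemma size_descents n (S : {set 'S_n}) b : b \in descents S -> size b = n.-1.
Proof. by case/mapP => w _ ->; apply: size_Des_bits. Qed.

Definition Fsum n (M : seq bitseq) : series := fun s =>
  Posz (if size s == n then count (fun b => below b (asc (sort leq s))) M else 0).

Lemma Posz_sum (T : Type) (r : seq T) (f : T -> nat) :
  (\sum_(i <- r) Posz (f i))%R = Posz (\sum_(i <- r) f i).
Proof. by elim: r => [|x r IH]; rewrite ?big_nil // !big_cons IH. Qed.

Lemma QfunE n (S : {set 'S_n}) s : Qfun S s = Fsum n (descents S) s.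
Proof.
rewrite /Qfun /Fsum -big_enum /=.
under eq_bigr do rewrite DesE FcoefE ?size_Des_bits //.
rewrite Posz_sum; case: eqP => _ /=; last by rewrite big1_eq.
by rewrite count_sumE big_map.
Qed.

(** * Monomials as words, and their exponent compositions *)

Definition spell (xs al : seq nat) : seq nat := flatten [seq nseq p.2 p.1 | p <- zip xs al].

Definition word al := spell (iota 0 (size al)) al.

Lemma map_spell h xs al : map h (spell xs al) = spell (map h xs) al.
Proof.
by elim: xs al => [|x xs IH] [|a al] //; rewrite /spell /= map_cat map_nseq -/(spell _ _) IH.
Qed.

Lemma size_spell xs al : size xs = size al -> size (spell xs al) = sumn al.
Proof.
by elim: xs al => [|x xs IH] [|a al] //= [E]; rewrite /spell /= size_cat size_nseq -/(spell _ _) IH.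
Qed.

Lemma spell_map xs (f : nat -> nat) : spell xs (map f xs) = flatten [seq nseq (f x) x | x <- xs].
Proof. by elim: xs => //= x xs IH; rewrite /spell /= -/(spell _ _) IH. Qed.

Lemma spell_ge y xs al : all (leq y) xs -> all (leq y) (spell xs al).
Proof.
elim: xs al => [|x xs IH] [|a al] //= /andP[yx H].
by rewrite /spell /= all_cat all_nseq yx orbT IH.
Qed.

Lemma sorted_spell xs al : sorted ltn xs -> sorted leq (spell xs al).
Proof.
rewrite (sorted_pairwise ltn_trans) (sorted_pairwise leq_trans).
elim: xs al => [|x xs IH] [|a al] //= /andP[H sx].
rewrite /spell /= pairwise_cat -/(spell _ _) IH // andbT; apply/andP; split.
  apply/allrelP => y z; rewrite mem_nseq => /andP[_ /eqP ->].
  by apply/allP/spell_ge; apply: sub_all H => ?; apply: ltnW.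
by elim: a => //= a ->; rewrite andbT all_nseq leqnn orbT.
Qed.

Lemma asc_nseq a x : asc (nseq a x) = nseq a.-1 false.
Proof. by case: a => //= a; elim: a => //= a ->; rewrite ltnn. Qed.

Lemma below_false b k : size b = k -> below b (nseq k false) = (b == nseq k false).
Proof. by elim: b k => [|x b IH] [|k] //= [sb]; rewrite eqseq_cons -IH //; case: x. Qed.

Lemma below_cat b c d e : size b = size d -> below (b ++ c) (d ++ e) = below b d && below c e.
Proof. by elim: b d => [|x b IH] [|y d] //= [sb]; rewrite IH // andbA. Qed.

(** The word increases strictly exactly where one letter gives way to the next. Those are the bits
    left free between zero blocks, and all other bits of [b] must vanish. *)
Lemma fits_zero_blocks xs al b : sorted ltn xs -> size xs = size al -> 0 \notin al ->
    size b = (sumn al).-1 ->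
  fits (zero_blocks al) b = below b (asc (spell xs al)).
Proof.
elim: al xs b => [|a al IH] [|x xs] // b; first by move=> _ _ _ /size0nil ->.
rewrite inE negb_or => sx [E] /andP[a0 al0] sb.
rewrite /spell /= -/(spell _ _) size_nseq.
case: al xs E IH al0 sx sb => [|a' al] [|x' xs] // E IH al0 sx sb.
  rewrite /spell /= cats0 asc_nseq andbT below_false; last by move: sb; rewrite /= addn0.
  by rewrite take_oversize // sb /= addn0.
have sx' : sorted ltn (x' :: xs) by case/andP: sx.
have xx' : x < x' by case/andP: sx.
have a'0 : 0 < a' by move: al0; rewrite inE negb_or; lia.
case: a a0 sb => // a _ sb; rewrite [a.+1.-1]/=.
have sb' : a < size b by move: sb => /= ->; lia.
have bE : b = take a b ++ nth false b a :: drop a.+1 b by rewrite -drop_nth // cat_take_drop.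
have sta : size (take a b) = a by rewrite size_takel // ltnW.
have H : fits (zero_blocks (a' :: al)) (drop a.+1 b) = below (drop a.+1 b) (asc (spell (x' :: xs) (a' :: al))).
  by apply: IH => //; rewrite size_drop sb /=; lia.
rewrite -/(zero_blocks (a' :: al)) -/(fits _ _) H.
have [t tE] : exists t, spell (x' :: xs) (a' :: al) = x' :: t.
  by case: (a') a'0 => // c _; exists (nseq c x' ++ spell xs al).
have lE : last x (nseq a x) = x by elim: (a).
rewrite tE [nseq a.+1 x]/= asc_cat lE xx' -[x :: nseq a x]/(nseq a.+1 x) asc_nseq.
by rewrite [in RHS]bE below_cat ?size_nseq // below_false //= implybT.
Qed.

(** Rearranging the exponents amounts to permuting the variables. *)
Lemma perm_spell_word al be : perm_eq al be ->
  exists2 sigma : nat -> nat, bijective sigma & perm_eq (map sigma (word be)) (word al).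
Proof.
rewrite perm_sym => /(perm_iotaP 0)[Is pI ->].
set k := size al in pI *.
have uI : uniq Is by rewrite (perm_uniq pI) iota_uniq.
have mI i : (i \in Is) = (i < k) by rewrite (perm_mem pI) mem_iota.
have sI : size Is = k by rewrite (perm_size pI) size_iota.
(* Letters beyond the word are fixed, which extends the permutation of positions to a bijection of
   [nat]. *)
exists (fun i => if i < k then nth 0 Is i else i).
  exists (fun i => if i < k then index i Is else i) => i /=.
    have [ik|ik] := boolP (i < k); last by rewrite (negbTE ik).
    by rewrite -mI mem_nth ?sI // index_uniq ?sI.
  have [ik|ik] := boolP (i < k); last by rewrite (negbTE ik).
  by rewrite -[X in _ < X]sI index_mem mI ik nth_index ?mI.
rewrite /word map_spell size_map sI.
have -> : [seq (if i < k then nth 0 Is i else i) | i <- iota 0 k] = Is.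
  apply: (@eq_from_nth _ 0); rewrite size_map size_iota // => i ik.
  by rewrite (nth_map 0) ?size_iota // nth_iota // ik.
rewrite spell_map -/k -{2}(mkseq_nth 0 al) /mkseq spell_map.
exact/perm_flatten/perm_map.
Qed.

Lemma Fsum_perm n M s t : perm_eq s t -> Fsum n M s = Fsum n M t.
Proof.
move=> p; rewrite /Fsum (perm_size p).
by rewrite (perm_sortP leq_total leq_trans anti_leq _ _ p).
Qed.

Lemma sort_word al : sort leq (word al) = word al.
Proof. by apply/(sorted_sort leq_trans)/sorted_spell/iota_ltn_sorted. Qed.

Lemma Fsum_word n M al : (forall b, b \in M -> size b = n.-1) -> sumn al = n -> 0 \notin al ->
  Fsum n M (word al) = Posz (count (fits (zero_blocks al)) M).
Proof.
move=> szM sal al0; rewrite /Fsum size_spell ?size_iota // sal eqxx sort_word.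
congr Posz; apply: eq_in_count => b Mb.
by rewrite -fits_zero_blocks ?size_iota ?iota_ltn_sorted // sal szM.
Qed.

(** Zero-block counts are coefficients by [Fsum_word], and permuting the blocks renames the
    variables of the monomial; [block_symmetric_zero] extends this to all blocks. *)
Lemma block_symmetric_of_series n M : (forall b, b \in M -> size b = n) ->
  is_symmetric (Fsum n.+1 M) -> block_symmetric n.+1 M.
Proof.
move=> szM symM; apply: block_symmetric_zero => [b /szM -> //|al be pab sal].
(* A zero block of length [a] belongs to a part [a + 1], whence the [map S]. *)
have zE c : [seq nseq a false | a <- c] = zero_blocks (map S c).
  by rewrite /zero_blocks -map_comp.
have z0 c : 0 \notin map S c by apply/mapP => -[].
have [sigma bij_s ps] := perm_spell_word (perm_map S pab).
have /eqP := symM sigma bij_s (word (map S be)).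
have sbe : sumn (map S be) = n.+1 by rewrite -sal; apply/esym/perm_sumn/perm_map.
by rewrite (Fsum_perm _ _ ps) !Fsum_word // -!zE => /eqP [].
Qed.

Definition content s := [seq count_mem x s | x <- sort leq (undup s)].

Lemma word_relabel s : exists2 h, {mono h : x y / x <= y} & perm_eq s (map h (word (content s))).
Proof.
set u := sort leq (undup s).
have su : sorted ltn u by rewrite ltn_sorted_uniq_leq sort_uniq undup_uniq sort_sorted //; exact: leq_total.
(* Past the letters of [s], the map continues above [sumn s], which bounds every letter, so it stays
   increasing on all of [nat]. *)
exists (fun i => if i < size u then nth 0 u i else (sumn s).+1 + i).
  apply: leq_mono => i j ij; case: ifP => hi; case: ifP => hj; try lia.
    exact: (sorted_ltn_nth ltn_trans).
  have : nth 0 u i \in s by rewrite -mem_undup -(mem_sort leq) mem_nth.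
  by move=> /perm_to_rem/perm_sumn -> /=; lia.
rewrite /word map_spell size_map -/u.
have -> : [seq (if i < size u then nth 0 u i else (sumn s).+1 + i) | i <- iota 0 (size u)] = u.
  apply: (@eq_from_nth _ 0); rewrite size_map size_iota // => i ik.
  by rewrite (nth_map 0) ?size_iota // nth_iota // ik.
rewrite /content -/u spell_map -(permPl (perm_count_undup s)).
by rewrite perm_sym; apply/perm_flatten/perm_map; rewrite perm_sort.
Qed.

Lemma content_gt0 s : 0 \notin content s.
Proof.
apply/mapP => -[x]; rewrite mem_sort mem_undup -has_pred1 has_count.
by case: (count _ _).
Qed.

Lemma sumn_content s : sumn (content s) = size s.
Proof.
have [h _ /perm_size ->] := word_relabel s.
by rewrite size_map size_spell ?size_iota.
Qed.

Lemma asc_map h t : {mono h : x y / x <= y} -> asc (map h t) = asc t.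
Proof.
move=> hm; case: t => //= x t; elim: t x => //= y t IH x.
by rewrite IH !ltnNge hm.
Qed.

Lemma Fsum_map n M h s : {mono h : x y / x <= y} -> Fsum n M (map h s) = Fsum n M s.
Proof.
move=> hm; rewrite /Fsum size_map.
have -> : sort leq (map h s) = map h (sort leq s); last by rewrite asc_map.
apply: (sorted_eq leq_trans anti_leq); first exact/sort_sorted/leq_total.
  by rewrite sorted_map (eq_sorted (e' := leq)) ?sort_sorted //; exact: leq_total.
by rewrite perm_sort perm_map // perm_sym perm_sort.
Qed.

(** This is quasisymmetry: an increasing renaming of the variables preserves coefficients. *)
Lemma FsumE n M s : Fsum n M s = Fsum n M (word (content s)).
Proof. by have [h hm /Fsum_perm ->] := word_relabel s; rewrite Fsum_map. Qed.

Lemma content_map sigma s : injective sigma -> perm_eq (content (map sigma s)) (content s).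
Proof.
move=> si; rewrite /content.
have p t : perm_eq [seq count_mem x t | x <- sort leq (undup t)] [seq count_mem x t | x <- undup t].
  by rewrite perm_map // perm_sort.
rewrite (permPl (p _)) perm_sym (permPl (p _)) undup_map_inj // -map_comp.
rewrite (eq_map (_ : _ =1 (fun x => count_mem x s))) // => x /=.
by rewrite count_map; apply: eq_count => y /=; rewrite inj_eq.
Qed.

Lemma mem_comps al : 0 \notin al -> al \in comps (sumn al).
Proof.
have [n le] := ubnP (sumn al); elim: n al le => // n IH [|[|a] al] // le al0.
have al0' : 0 \notin al by apply: contra al0; rewrite inE orbC => ->.
rewrite [sumn _]/= addSn /=; apply/flatten_mapP.
case: a le {al0} => [|a] le.
  by exists al; rewrite ?mem_head // IH //; move: le => /=; lia.
exists (a.+1 :: al); last by rewrite inE mem_head orbT.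
by rewrite -[_ + _]/(sumn (a.+1 :: al)) IH //; move: le => /=; lia.
Qed.

(** Renaming the variables permutes the content, and the test equates the counts of contents with
    the same sorted form. *)
Lemma symmetric_test_series n M : (forall b, b \in M -> size b = n.-1) ->
  symmetric_test n M -> is_symmetric (Fsum n M).
Proof.
move=> szM /allP tM sigma /bij_inj si s.
have [sn|sn] := eqVneq (size s) n; last by rewrite /Fsum size_map (negbTE sn).
rewrite FsumE [RHS]FsumE !Fsum_word ?content_gt0 ?sumn_content ?size_map //.
have E t : size t = n -> count (fits (zero_blocks (content t))) M =
    count (fits (zero_blocks (sort geq (content t)))) M.
  move=> tn; have := tM (content t); rewrite -tn -sumn_content mem_comps ?content_gt0 // => /(_ isT).
  have -> : wt (zero_blocks (content t)) = sumn (content t).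
    rewrite /wt -map_comp -[in RHS](map_id (content t)); congr sumn.
    apply/eq_in_map => a ta /=; rewrite size_nseq prednK // lt0n.
    by apply: contraNneq (content_gt0 t) => <-.
  by rewrite eqxx => /eqP.
rewrite (E _ sn) E ?size_map //; congr (Posz (count (fits (zero_blocks _)) _)).
apply/(perm_sortP _ _ _ _ _ (content_map s si)).
- by move=> x y; apply: leq_total.
- by move=> x y z /= yx xz; apply: leq_trans xz yx.
- by move=> x y /andP[yx xy]; apply/anti_leq/andP.
Qed.

(** * Schur functions of the exceptional shapes *)

Lemma undup_permutations (T : eqType) (s : seq T) : undup (permutations s) = permutations s.
Proof. exact/undup_id/permutations_uniq. Qed.

Lemma schur_perm lam s t : perm_eq s t -> schur lam s = schur lam t.
Proof.
move=> p; rewrite /schur (perm_size p) !undup_permutations.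
by have /seq.permP -> := perm_permutations p.
Qed.

Lemma perm_map_permutations (T U : eqType) (h : T -> U) s : injective h ->
  perm_eq (permutations (map h s)) (map (map h) (permutations s)).
Proof.
move=> hi; apply: uniq_perm; rewrite ?permutations_uniq //.
  by rewrite map_inj_uniq ?permutations_uniq //; exact: inj_map.
move=> t; rewrite mem_permutations perm_sym; apply/idP/mapP.
  by move=> /perm_map_lift[t' pt <-]; exists t'; rewrite // mem_permutations perm_sym.
by move=> [t']; rewrite mem_permutations => pt ->; rewrite perm_map // perm_sym.
Qed.

Lemma schur_map lam h s : {mono h : x y / x <= y} ->
    (forall p, size p = sumn lam -> is_ssyt (reshape lam (map h p)) = is_ssyt (reshape lam p)) ->
  schur lam (map h s) = schur lam s.
Proof.
move=> hm E; rewrite /schur size_map; case: eqP => // sl.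
have hi : injective h by move=> x y /eqP; rewrite eqn_leq !hm -eqn_leq => /eqP.
rewrite !undup_permutations (seq.permP (perm_map_permutations s hi)) count_map; congr Posz.
apply: eq_in_count => p; rewrite mem_permutations => /perm_size ps /=.
by rewrite E // ps.
Qed.

(** Both series are unchanged under increasing renamings, so one word per composition suffices and
    the identity becomes a finite computation. *)
Lemma Fsum_schur_of_words n M lam : sumn lam = n ->
    (forall h : nat -> nat, {mono h : x y / x <= y} -> forall p, size p = n ->
       is_ssyt (reshape lam (map h p)) = is_ssyt (reshape lam p)) ->
    all (fun al => (sumn al == n) ==> (Fsum n M (word al) == schur lam (word al))) (comps n) ->
  forall s, Fsum n M s = schur lam s.
Proof.
move=> sl hE /allP H s.
have [sn|sn] := eqVneq (size s) n; last by rewrite /Fsum /schur sl [n == _]eq_sym (negbTE sn).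
have [h hm /[dup] /schur_perm -> _] := word_relabel s.
rewrite FsumE schur_map //; last by rewrite sl; apply: hE.
have := H (content s); rewrite -[X in comps X]sn -sumn_content mem_comps ?content_gt0 //.
by rewrite sumn_content sn eqxx => /(_ isT)/eqP.
Qed.

Lemma Fsum_schur22 s : Fsum 4 bits22 s = schur [:: 2; 2] s.
Proof.
apply: Fsum_schur_of_words; [by []| |by vm_compute].
move=> h hm p; have hl : {mono h : x y / x < y} by move=> x y; rewrite !ltnNge hm.
by case: p => [|a [|b [|c [|d []]]]] //= _; rewrite /is_ssyt /= !hm !hl.
Qed.

Lemma Fsum_schur33 s : Fsum 6 bits33 s = schur [:: 3; 3] s.
Proof.
apply: Fsum_schur_of_words; [by []| |by vm_compute].
move=> h hm p; have hl : {mono h : x y / x < y} by move=> x y; rewrite !ltnNge hm.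
by case: p => [|a [|b [|c [|d [|e [|f []]]]]]] //= _; rewrite /is_ssyt /= !hm !hl.
Qed.

Lemma Fsum_schur222 s : Fsum 6 bits222 s = schur [:: 2; 2; 2] s.
Proof.
apply: Fsum_schur_of_words; [by []| |by vm_compute].
move=> h hm p; have hl : {mono h : x y / x < y} by move=> x y; rewrite !ltnNge hm.
by case: p => [|a [|b [|c [|d [|e [|f []]]]]]] //= _; rewrite /is_ssyt /= !hm !hl.
Qed.

(** * Schur functions of row, column and hook shape *)

Lemma below_nseq_false k c : size c = k -> below (nseq k false) c.
Proof. by elim: c k => [|x c IH] [|k] //= [sc]; apply: IH. Qed.

Lemma below_nseq_true k c : size c = k -> below (nseq k true) c = (count negb c == 0).
Proof.
by elim: c k => [|x c IH] [|k] //= [sc]; rewrite IH //; case: x.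
Qed.

Lemma single0 m : single m.+1 0 = true :: nseq m false.
Proof.
rewrite /single /= (iotaDl 1 0) -map_comp; congr cons.
by rewrite -[in RHS](size_iota 0 m); elim: (iota 0 m) => //= i r ->.
Qed.

Lemma singleS m i : single m.+1 i.+1 = false :: single m i.
Proof. by rewrite /single /= (iotaDl 1 0) -map_comp. Qed.

Lemma below_single m i c : size c = m -> i < m -> below (single m i) c = nth false c i.
Proof.
elim: c m i => [|x c IH] [|m] [|i] // [sc] im; last by rewrite singleS /= IH.
by rewrite single0 /= below_nseq_false // andbT.
Qed.

(** Every zero of [c] has to sit at [i], so the number of zeros is 0 or 1 according to the bit at
    [i]. *)
Lemma below_cosingle m i c : size c = m -> i < m ->
  below (map negb (single m i)) c = (count negb c == ~~ nth false c i).
Proof.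
elim: c m i => [|x c IH] [|m] [|i] // [sc] im; last first.
  rewrite singleS /= IH //; case: x => //=; rewrite add1n.
  case: (boolP (nth false c i)) => //= ni; rewrite eqSS; apply/esym/negbTE.
  by rewrite -lt0n -has_count; apply/(has_nthP false); exists i; rewrite // sc.
by rewrite single0 /= map_nseq below_nseq_true //; case: x.
Qed.

Lemma count_nth_iota (c : bitseq) a :
  count (fun i => a (nth false c i)) (iota 0 (size c)) = count a c.
Proof. by rewrite -[in RHS](mkseq_nth false c) count_map. Qed.

Lemma count_below_singles c : count (fun b => below b c) (singles (size c)) = count id c.
Proof.
rewrite count_map -(count_nth_iota c id); apply: eq_in_count => i.
by rewrite mem_iota => /andP[_ im]; rewrite /= below_single.
Qed.

Lemma count_below_cosingles c : count (fun b => below b c) (cosingles (size c)) =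
  if count negb c == 0 then size c else count negb c == 1.
Proof.
rewrite /cosingles /singles -map_comp count_map.
have E x : count (fun i => count negb c == ~~ nth false c i) (iota 0 (size c)) = x ->
   count (preim ((map negb \o single (size c))) (below^~ c)) (iota 0 (size c)) = x.
  move=> <-; apply: eq_in_count => i.
  by rewrite mem_iota => /andP[_ im]; rewrite /= below_cosingle.
apply: E; rewrite (count_nth_iota c (fun x => count negb c == ~~ x)).
have [z|] := count negb c =P 0.
  rewrite -(count_predC id c) [count (predC _) c]z addn0.
  by apply: eq_count => -[].
have [z _|z1 z0] := count negb c =P 1.
  by rewrite z -[RHS]z; apply: eq_count => -[].
by apply/eqP; rewrite -leqn0 leqNgt -has_count; apply/hasPn => -[] _; apply/eqP.
Qed.

Lemma size_undup_sorted x t : sorted leq (x :: t) -> size (undup (x :: t)) = (count id (asc (x :: t))).+1.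
Proof.
elim: t x => //= y t IH x /andP[xy pt].
have := IH y pt; rewrite /= -addnS => <-; rewrite inE.
have [<-|neq] := eqVneq x y; first by rewrite ltnn.
have xlty : x < y by rewrite ltn_neqAle neq.
rewrite xlty orFb ifN //=; apply/negP => xt.
by have := allP (order_path_min leq_trans pt) x xt; rewrite leqNgt xlty.
Qed.

(** In a sorted list each strict increase introduces one new letter; the first letter accounts for
    the [.-1]. *)
Lemma count_id_asc s : count id (asc (sort leq s)) = (size (undup s)).-1.
Proof.
have ->: size (undup s) = size (undup (sort leq s)).
  by apply/perm_size/perm_undup => x; rewrite mem_sort.
by have := sort_sorted leq_total s; case: (sort leq s) => // x t /size_undup_sorted ->.
Qed.

Lemma count_negb_asc s : count negb (asc (sort leq s)) = size s - size (undup s).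
Proof.
have := count_predC id (asc (sort leq s)).
rewrite size_asc size_sort count_id_asc -[count (predC _) _]/(count negb _).
case: s => // x s; have : 0 < size (undup (x :: s)).
  by rewrite -has_predT; apply/hasP; exists x; rewrite ?mem_undup ?mem_head.
by have := size_undup (x :: s); move: (count _ _) (size (undup _)) => i j /=; lia.
Qed.

Lemma Fsum_zeros n s : Fsum n [:: nseq n.-1 false] s = Posz (size s == n).
Proof.
rewrite /Fsum; case: eqP => //= sn.
by rewrite below_nseq_false // size_asc size_sort sn.
Qed.

Lemma Fsum_ones n s : Fsum n [:: nseq n.-1 true] s = Posz ((size s == n) && uniq s).
Proof.
rewrite /Fsum; case: eqP => //= sn.
rewrite below_nseq_true ?size_asc ?size_sort ?sn // addn0 count_negb_asc.
by rewrite subn_eq0 leqNgt ltn_size_undup negbK.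
Qed.

Lemma Fsum_singles m s :
  Fsum m.+1 (singles m) s = Posz (if size s == m.+1 then (size (undup s)).-1 else 0).
Proof.
rewrite /Fsum; case: eqP => //= sn.
by rewrite -count_id_asc -count_below_singles size_asc size_sort sn.
Qed.

Lemma Fsum_cosingles m s :
  Fsum m.+1 (cosingles m) s = Posz (if size s == m.+1 then
     if uniq s then m else size (undup s) == m else 0).
Proof.
rewrite /Fsum; case: eqP => //= sn; congr Posz.
have -> : m = size (asc (sort leq s)) by rewrite size_asc size_sort sn.
rewrite count_below_cosingles count_negb_asc size_asc size_sort sn /=.
have := size_undup s; rewrite -sn -[uniq s]negbK -ltn_size_undup sn => le.
have -> : (m.+1 - size (undup s) == 0) = ~~ (size (undup s) < m.+1) by rewrite subn_eq0 leqNgt.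
by case: ifP => // _; congr nat_of_bool; apply/eqP/eqP; lia.
Qed.

Lemma schur_row n s : 0 < n -> schur [:: n] s = Posz (size s == n).
Proof.
move=> n0; rewrite /schur /= addn0 eq_sym; case: eqP => // sn.
rewrite undup_permutations; congr Posz.
rewrite (@eq_in_count _ _ (pred1 (sort leq s))).
  by rewrite count_uniq_mem ?permutations_uniq // mem_permutations perm_sort perm_refl.
move=> p; rewrite mem_permutations => pp.
rewrite /is_ssyt /= take_oversize ?(perm_size pp) ?sn // !andbT.
apply/idP/eqP => [sp|->]; last exact/sort_sorted/leq_total.
apply: (sorted_eq leq_trans anti_leq) => //; first exact/sort_sorted/leq_total.
by rewrite perm_sym perm_sort perm_sym.
Qed.

Lemma reshape_col (p : seq nat) : reshape (nseq (size p) 1) p = [seq [:: x] | x <- p].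
Proof. by elim: p => //= x p IH; rewrite take0 drop0 IH. Qed.

(** Rows after the first have one cell, so only the first column is constrained. *)
Lemma columns_sorted r (p : seq nat) x :
  all (fun i => all (fun c => nth 0 (nth [::] ((x :: r) :: [seq [:: y] | y <- p]) i) c <
       nth 0 (nth [::] ((x :: r) :: [seq [:: y] | y <- p]) i.+1) c)
      (iota 0 (size (nth [::] ((x :: r) :: [seq [:: y] | y <- p]) i.+1))))
    (iota 0 (size p)) = path ltn x p.
Proof.
elim: p x r => //= y p IH x r; rewrite -(IH y [::]) andbT (iotaDl 1 0) all_map.
by congr andb; apply: eq_all => i /=.
Qed.

Lemma is_ssyt_hook x r p :
  is_ssyt ((x :: r) :: [seq [:: y] | y <- p]) = sorted leq (x :: r) && path ltn x p.
Proof.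
rewrite /is_ssyt -(columns_sorted r) /= size_map; congr andb.
have -> : all (sorted leq) [seq [:: y] | y <- p] by rewrite all_map; apply/allP.
by rewrite andbT.
Qed.

Lemma schur_column n s : 0 < n -> schur (nseq n 1) s = Posz ((size s == n) && uniq s).
Proof.
move=> n0; rewrite /schur sumn_nseq mul1n eq_sym; case: eqP => // sn.
rewrite undup_permutations; congr Posz.
have E p : perm_eq p s -> is_ssyt (reshape (nseq n 1) p) = uniq s && (p == sort leq s).
  move=> pp; rewrite -sn -(perm_size pp) reshape_col.
  case: p pp => [|x p] pp; first by move: n0; rewrite -sn -(perm_size pp).
  rewrite (is_ssyt_hook x [::]) andTb -[path _ _ _]/(sorted ltn (x :: p)) ltn_sorted_uniq_leq.
  rewrite (perm_uniq pp); congr andb; apply/idP/eqP => [sp|->]; last exact/sort_sorted/leq_total.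
  apply: (sorted_eq leq_trans anti_leq) => //; first exact/sort_sorted/leq_total.
  by rewrite perm_sym perm_sort perm_sym.
rewrite (@eq_in_count _ _ (fun p => uniq s && (p == sort leq s))); last first.
  by move=> p; rewrite mem_permutations => /E.
case: (uniq s); last by rewrite count_pred0.
by rewrite count_uniq_mem ?permutations_uniq // mem_permutations perm_sort perm_refl.
Qed.

(* A filling of a hook is a single entry [x] together with the sorted list of the
   other entries, [e x q] being its reading word. *)
Lemma count_arrangements m (e : nat -> seq nat -> seq nat) (P : pred (seq nat))
    (R : nat -> seq nat -> bool) s : size s = m.+1 ->
    (forall x q, size q = m -> perm_eq (e x q) (x :: q)) ->
    (forall x q y r, size q = m -> size r = m -> e x q = e y r -> x = y) ->
    (forall p, size p = m.+1 -> exists x, exists2 q, size q = m & p = e x q) ->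
    (forall x q, size q = m -> P (e x q) = sorted leq q && R x q) ->
  count P (permutations s) = count (fun x => R x (sort leq (rem x s))) (undup s).
Proof.
move=> ss pe inje surje PE.
have sr x : x \in s -> size (sort leq (rem x s)) = m by move=> xs; rewrite size_sort size_rem // ss.
rewrite -!size_filter -[RHS](size_map (fun x => e x (sort leq (rem x s)))).
apply/perm_size/uniq_perm.
- exact/filter_uniq/permutations_uniq.
- rewrite map_inj_in_uniq ?filter_uniq ?undup_uniq // => x y.
  by rewrite !mem_filter !mem_undup => /andP[_ xs] /andP[_ ys]; apply: inje; apply: sr.
move=> p; rewrite mem_filter mem_permutations; apply/andP/mapP; last first.
  case=> x; rewrite mem_filter mem_undup => /andP[Rx xs] ->.
  rewrite PE ?sr // Rx (sort_sorted leq_total).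
  split=> //; rewrite (permPl (pe _ _ (sr _ xs))) perm_sym (permPl (perm_to_rem xs)) perm_cons.
  by rewrite perm_sym perm_sort.
case=> Pp pp; have [x [q sq pE]] := surje p (etrans (perm_size pp) ss).
move: Pp pp; rewrite pE PE // (permPl (pe _ _ sq)) => /andP[qs Rq] pxq.
have xs : x \in s by rewrite -(perm_mem pxq) mem_head.
have qE : q = sort leq (rem x s).
  apply: (sorted_eq leq_trans anti_leq) => //; first exact/sort_sorted/leq_total.
  by rewrite perm_sym perm_sort perm_sym -(perm_cons x) (permPl pxq) perm_to_rem.
by exists x; rewrite -?qE // mem_filter -qE Rq mem_undup.
Qed.

Lemma head_sort_le x s : x \in s -> head 0 (sort leq s) <= x.
Proof.
rewrite -(mem_sort leq); have := sort_sorted leq_total s.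
case: (sort leq s) => //= y t /(order_path_min leq_trans)/allP H.
by rewrite inE => /orP[/eqP->|/H].
Qed.

Lemma head_sort_mem s : 0 < size s -> head 0 (sort leq s) \in s.
Proof.
rewrite -(size_sort leq) -[in X in _ -> X](mem_sort leq).
by case: (sort leq s) => //= x t _; rewrite mem_head.
Qed.

(** If [x] is not the minimum, the minimum survives its removal; if it is, no remaining letter is
    smaller. *)
Lemma head_sort_rem x s : x \in s -> 1 < size s ->
  (head 0 (sort leq (rem x s)) < x) = (x != head 0 (sort leq s)).
Proof.
move=> xs s2; have s0 : 0 < size s by apply: ltnW.
apply/idP/idP => [lt|neq].
  apply: contraTneq lt => ->; rewrite -leqNgt; apply: head_sort_le.
  apply: (mem_rem (x := head 0 (sort leq s))).
  by rewrite head_sort_mem // size_rem ?head_sort_mem // -ltnS prednK.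
have hr : head 0 (sort leq s) \in rem x s.
  have := head_sort_mem s0; rewrite {1}(perm_mem (perm_to_rem xs)) inE eq_sym.
  by rewrite (negbTE neq).
by apply: leq_ltn_trans (head_sort_le hr) _; rewrite ltn_neqAle eq_sym neq head_sort_le.
Qed.

Lemma count_neq_head s : 0 < size s ->
  count (fun x => x != head 0 (sort leq s)) (undup s) = (size (undup s)).-1.
Proof.
move=> s0; rewrite -(count_predC (pred1 (head 0 (sort leq s))) (undup s)).
by rewrite count_uniq_mem ?undup_uniq // mem_undup head_sort_mem.
Qed.

(** The entry [x] of the second row determines the tableau, and it can be any letter except the
    smallest. *)
Lemma schur_hook_row m s : 0 < m ->
  schur [:: m; 1] s = Posz (if size s == m.+1 then (size (undup s)).-1 else 0).
Proof.
move=> m0; rewrite /schur /= addn0 addn1 eq_sym; case: eqP => // ss.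
rewrite undup_permutations; congr Posz.
rewrite (@count_arrangements m (fun x q => rcons q x) _ (fun x q => head 0 q < x)) //.
- rewrite -count_neq_head ?ss //; apply: eq_in_count => x; rewrite mem_undup => xs.
  by rewrite head_sort_rem // ss.
- by move=> x q _; rewrite perm_rcons.
- by move=> x q y r _ _ /rcons_inj[].
- move=> p; case/lastP: p => // p x; rewrite size_rcons => -[sp].
  by exists x, p.
move=> x q sq; rewrite -sq -cats1 take_size_cat // drop_size_cat //.
by case: q sq => [|y q] sq; [rewrite -sq in m0|rewrite /is_ssyt /= !andbT].
Qed.

(** Removing a letter removes all repetitions only if it occurs twice and is the only repeated
    letter; at most one letter qualifies. *)
Lemma count_uniq_rem (s : seq nat) : ~~ uniq s ->
  count (fun x => uniq (rem x s)) (undup s) = (size (undup s) == (size s).-1).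
Proof.
move=> nu.
have dup x : uniq (rem x s) -> x \in s -> x \in rem x s.
  move=> ur xs; apply: contraR nu => xr; rewrite (perm_uniq (perm_to_rem xs)) /= xr ur.
  by [].
have [[x xs ur]|none] := altP (@hasP _ (fun x => uniq (rem x s)) s).
  have sE : size (undup s) = (size s).-1.
    rewrite -(size_rem xs) -(undup_id ur); apply/perm_size/uniq_perm; rewrite ?undup_uniq //.
    move=> y; rewrite !mem_undup; apply/idP/idP => [ys|/mem_rem //].
    have [->|yx] := eqVneq y x; first exact: dup.
    by move: ys; rewrite (perm_mem (perm_to_rem xs)) inE (negbTE yx).
  rewrite sE eqxx (@eq_in_count _ _ (pred1 x)) ?count_uniq_mem ?undup_uniq ?mem_undup ?xs //.
  move=> y; rewrite mem_undup => ys /=; apply/idP/eqP => [ury|-> //].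
  apply: contraTeq ury => yx.
  have /seq.permP/(_ (pred1 x)) := perm_to_rem ys; have /seq.permP/(_ (pred1 x)) := perm_to_rem xs.
  rewrite /= eqxx (negbTE yx) => -> /= E.
  apply/negP => ury; move: E; rewrite !count_uniq_mem // dup //.
  by case: (_ \in _).
rewrite (@eq_in_count _ _ pred0) ?count_pred0; last first.
  by move=> x; rewrite mem_undup => xs; apply/negbTE; apply: contra none => ?; apply/hasP; exists x.
case: eqP => // sE; case/negP: none.
have [x xs xr] : exists2 x, x \in s & x \in rem x s.
  apply/hasP; apply: contraR nu => /hasPn H; apply: count_mem_uniq => x.
  case: (boolP (x \in s)) => [xs|]; last by rewrite -has_pred1 has_count; case: (count _ _).
  have := H x xs; have /seq.permP-> := perm_to_rem xs; rewrite /= eqxx -has_pred1 has_count.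
  by case: (count _ _).
apply/hasP; exists x => //; apply: (leq_size_uniq (undup_uniq s)) => [y|].
  rewrite mem_undup (perm_mem (perm_to_rem xs)) inE => /orP[/eqP-> //|//].
by rewrite size_rem // sE.
Qed.

(** Here [x] is the second entry of the first row and [q] the first column. With distinct letters
    [x] is anything but the minimum; otherwise it must be the repeated letter. *)
Lemma schur_hook_column m s : 0 < m ->
  schur (2 :: nseq m.-1 1) s = Posz (if size s == m.+1 then
     if uniq s then m else size (undup s) == m else 0).
Proof.
case: m => // k _; rewrite /schur /= sumn_nseq mul1n add2n eq_sym; case: eqP => // ss.
rewrite undup_permutations; congr Posz.
(* The first row is read first, so [x] comes directly after the corner. *)
pose e x q := head 0 q :: x :: behead q.
rewrite (@count_arrangements k.+1 e _ (fun x q => uniq q && (head 0 q <= x))) //.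
- have [us|us] := boolP (uniq s).
    transitivity (size (undup s)).-1; last by rewrite undup_id // ss.
    rewrite -count_neq_head ?ss //.
    apply: eq_in_count => x; rewrite mem_undup => xs.
    (* Letters being distinct, the weak inequality in the row is strict and [head_sort_rem]
       applies. *)
    rewrite sort_uniq rem_uniq //= -head_sort_rem ?ss // leq_eqVlt.
    case: eqP => // E; have : x \in rem x s by rewrite -{1}E head_sort_mem // size_rem // ss.
    by rewrite mem_rem_uniq // inE eqxx.
  rewrite -[X in _ == X]/(k.+2.-1) -ss -count_uniq_rem //.
  apply: eq_in_count => x; rewrite mem_undup => xs; rewrite sort_uniq.
  have [ur|//] := boolP (uniq _); rewrite head_sort_le //.
  by apply: contraR us => xr; rewrite (perm_uniq (perm_to_rem xs)) /= xr ur.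
- by move=> x [|y q] // _; rewrite /e /= (perm_catCA [:: y] [:: x]).
- by move=> x q y r _ _ [].
- by case=> [|y [|x p]] // [sp]; exists x, (y :: p) => //=; rewrite sp.
move=> x [|y q] // [sq]; rewrite /e /= take0 drop0 -sq reshape_col is_ssyt_hook.
rewrite -[path _ _ _]/(sorted ltn (y :: q)) ltn_sorted_uniq_leq /= andbT.
by rewrite andbC -andbA andbCA.
Qed.

(** * Schur positivity *)

Lemma is_symmetric_ext f g : f =1 g -> is_symmetric f -> is_symmetric g.
Proof. by move=> fg sf sigma bs s; rewrite -!fg; apply: sf. Qed.

Lemma schur_positive_ext f g : f =1 g -> schur_positive f -> schur_positive g.
Proof.
move=> fg [sf [l [H1 [H2 H3]]]]; split; first exact: is_symmetric_ext fg sf.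
by exists l; split=> //; split=> // s; rewrite -fg.
Qed.

Lemma schur_positive_schur lam f : is_partition lam -> is_symmetric f -> f =1 schur lam ->
  schur_positive f.
Proof.
move=> pl sf E; split=> //; exists [:: (lam, 1%R)]; rewrite /= pl; split=> //; split=> // s.
by rewrite big_seq1 E GRing.mul1r.
Qed.

Lemma schur_positive_perm n M N : perm_eq M N ->
  schur_positive (Fsum n M) -> schur_positive (Fsum n N).
Proof. by move=> /seq.permP p; apply: schur_positive_ext => s; rewrite /Fsum p. Qed.

Lemma schur_positive_nil n : schur_positive (Fsum n [::]).
Proof.
have E s : Fsum n [::] s = 0%R by rewrite /Fsum /= if_same.
split=> [sigma _ s|]; first by rewrite !E.
by exists [::]; split=> //; split=> // s; rewrite E big_nil.
Qed.

Lemma schur_positive_cat n M N : schur_positive (Fsum n M) -> schur_positive (Fsum n N) ->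
  schur_positive (Fsum n (M ++ N)).
Proof.
have E s : Fsum n (M ++ N) s = (Fsum n M s + Fsum n N s)%R.
  by rewrite /Fsum count_cat; case: ifP.
move=> [sM [l [M1 [M2 M3]]]] [sN [k [N1 [N2 N3]]]]; split.
  by move=> sigma bs s; rewrite !E sM ?sN.
exists (l ++ k); rewrite !all_cat M1 M2 N1 N2; split=> //; split=> // s.
by rewrite E big_cat intrD M3 N3.
Qed.

Lemma schur_positive_zeros n : 0 < n -> schur_positive (Fsum n [:: nseq n.-1 false]).
Proof.
move=> n0; apply: (@schur_positive_schur [:: n]); first by rewrite /is_partition /= n0.
  by move=> sigma _ s; rewrite !Fsum_zeros size_map.
by move=> s; rewrite Fsum_zeros schur_row.
Qed.

Lemma schur_positive_ones n : 0 < n -> schur_positive (Fsum n [:: nseq n.-1 true]).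
Proof.
move=> n0; apply: (@schur_positive_schur (nseq n 1)).
- rewrite /is_partition all_nseq orbT andbT.
  by case: n {n0} => // n; rewrite /=; elim: n.
- by move=> sigma /bij_inj si s; rewrite !Fsum_ones size_map map_inj_uniq.
by move=> s; rewrite Fsum_ones schur_column.
Qed.

Lemma schur_positive_singles m : schur_positive (Fsum m.+1 (singles m)).
Proof.
case: m => [|m]; first exact: schur_positive_nil.
apply: (@schur_positive_schur [:: m.+1; 1]) => //.
  by move=> sigma /bij_inj si s; rewrite !Fsum_singles undup_map_inj // !size_map.
by move=> s; rewrite Fsum_singles schur_hook_row.
Qed.

Lemma schur_positive_cosingles m : schur_positive (Fsum m.+1 (cosingles m)).
Proof.
case: m => [|m]; first exact: schur_positive_nil.
apply: (@schur_positive_schur (2 :: nseq m 1)).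
- rewrite /is_partition /= all_nseq orbT andbT.
  by case: m => // m; rewrite /=; elim: m.
- move=> sigma /bij_inj si s.
  by rewrite !Fsum_cosingles undup_map_inj // !size_map map_inj_uniq.
by move=> s; rewrite Fsum_cosingles -(schur_hook_column s (ltn0Sn m)).
Qed.

Lemma schur_positive22 : schur_positive (Fsum 4 bits22).
Proof.
apply: (schur_positive_schur _ _ Fsum_schur22) => //.
by apply: symmetric_test_series; [move=> b Mb; apply/eqP; move: b Mb; apply/allP|vm_compute].
Qed.

Lemma schur_positive33 : schur_positive (Fsum 6 bits33).
Proof.
apply: (schur_positive_schur _ _ Fsum_schur33) => //.
by apply: symmetric_test_series; [move=> b Mb; apply/eqP; move: b Mb; apply/allP|vm_compute].
Qed.

Lemma schur_positive222 : schur_positive (Fsum 6 bits222).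
Proof.
apply: (schur_positive_schur _ _ Fsum_schur222) => //.
by apply: symmetric_test_series; [move=> b Mb; apply/eqP; move: b Mb; apply/allP|vm_compute].
Qed.

(** * Permutations and their descent vectors *)

Lemma oneline_inj n : injective (@oneline n).
Proof.
move=> w v E; apply/permP => i; apply: val_inj.
have nE (u : 'S_n) : nth 0 (oneline u) i = val (u i).
  by rewrite (nth_map i) ?size_enum_ord // nth_ord_enum.
by rewrite -!nE E.
Qed.

Lemma perm_oneline n (w v : 'S_n) : perm_eq (oneline w) (oneline v).
Proof.
have p (u : 'S_n) : perm_eq [seq u j | j <- enum 'I_n] (enum 'I_n).
  apply: uniq_perm; rewrite ?enum_uniq ?(map_inj_uniq perm_inj) ?enum_uniq // => i.
  by rewrite mem_enum; apply/mapP; exists ((u^-1)%g i); rewrite ?mem_enum ?permKV.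
rewrite /oneline !(map_comp val); apply: perm_map.
by rewrite (permPl (p w)) perm_sym.
Qed.

Lemma size_oneline n (w : 'S_n) : size (oneline w) = n.
Proof. by rewrite size_map size_enum_ord. Qed.

Lemma nth_Des_bits n (w : 'S_n) i : i.+1 < n ->
  nth false (Des_bits w) i = (nth 0 (oneline w) i.+1 < nth 0 (oneline w) i).
Proof.
move=> lt; have lt' : i < n.-1 by case: (n) lt.
by rewrite (nth_map 0) ?size_iota // nth_iota.
Qed.

(** A one-line notation without descents is sorted, and all one-line notations are rearrangements of
    each other. *)
Lemma Des_bits_false_inj n (w v : 'S_n) :
  Des_bits w = nseq n.-1 false -> Des_bits v = nseq n.-1 false -> w = v.
Proof.
have S (u : 'S_n) : Des_bits u = nseq n.-1 false -> sorted leq (oneline u).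
  move=> E; apply/(sortedP 0) => i; rewrite size_oneline => lt.
  by rewrite leqNgt -nth_Des_bits // E nth_nseq if_same.
move=> /S sw /S sv; apply/oneline_inj/(sorted_eq leq_trans anti_leq) => //.
exact: perm_oneline.
Qed.

Lemma Des_bits_true_inj n (w v : 'S_n) :
  Des_bits w = nseq n.-1 true -> Des_bits v = nseq n.-1 true -> w = v.
Proof.
have S (u : 'S_n) : Des_bits u = nseq n.-1 true -> sorted geq (oneline u).
  move=> E; apply/(sortedP 0) => i; rewrite size_oneline => lt /=.
  by apply: ltnW; rewrite -nth_Des_bits // E nth_nseq; case: (n) lt => //= k; rewrite ltnS => ->.
move=> /S sw /S sv; apply/oneline_inj/(@sorted_eq _ geq) => //.
- by move=> x y z /= yx xz; apply: leq_trans xz yx.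
- by move=> x y /andP[yx xy]; apply/anti_leq/andP.
exact: perm_oneline.
Qed.

Lemma Des_bits_iota n : Des_bits (iota_perm n) = nseq n.-1 false.
Proof.
rewrite -[in RHS](size_Des_bits (iota_perm n)).
apply/all_pred1P/allP => b /(nthP false)[i]; rewrite size_Des_bits => lt <-.
have E : oneline (iota_perm n) = iota 0 n.
  by rewrite -val_enum_ord; apply: eq_map => j; rewrite perm1.
rewrite /Des_bits E (nth_map 0) ?size_iota // nth_iota //= !nth_iota; lia.
Qed.

Lemma Des_bits_delta n : Des_bits (delta_perm n) = nseq n.-1 true.
Proof.
rewrite -[in RHS](size_Des_bits (delta_perm n)).
apply/all_pred1P/allP => b /(nthP false)[i]; rewrite size_Des_bits => lt <-.
have E : oneline (delta_perm n) = [seq n - i.+1 | i <- iota 0 n].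
  by rewrite -val_enum_ord -map_comp; apply: eq_map => j; rewrite /= permE.
rewrite /Des_bits E (nth_map 0) ?size_iota // nth_iota //= !(nth_map 0) ?size_iota ?nth_iota; lia.
Qed.

Definition bits_of n (D : seq nat) : bitseq := [seq i \in D | i <- iota 1 n.-1].

Lemma Des_bitsE n (w : 'S_n) : Des_bits w = bits_of n (Des w).
Proof. by apply/eq_in_map => i ii; rewrite mem_filter ii andbT. Qed.

(** [S =i ws] allows repetitions in [ws]; distinct descent sets exclude them, so the list counts
    each element of [S] once. *)
Lemma perm_descents n (S : {set 'S_n}) ws : S =i ws -> uniq (map (@Des n) ws) ->
  perm_eq (descents S) (map (bits_of n) (map (@Des n) ws)).
Proof.
move=> E /map_uniq u; rewrite -map_comp -(eq_map (@Des_bitsE n)); apply: perm_map.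
by apply: uniq_perm; rewrite ?enum_uniq // => w; rewrite mem_enum.
Qed.

Lemma descents_perm n (S : {set 'S_n}) L : perm_eq (descents S) L ->
  exists2 ws, S =i ws & map (@Des_bits n) ws = L.
Proof.
by case/perm_map_lift => ws /perm_mem E <-; exists ws => // w; rewrite -E mem_enum.
Qed.

Lemma decode_map n a : decode n [seq a i | i <- iota 1 n.-1] = filter a (iota 1 n.-1).
Proof. by rewrite /decode -filter_mask. Qed.

Lemma singleE m i : single m i = [seq j == i.+1 | j <- iota 1 m].
Proof. by rewrite (iotaDl 1 0) -map_comp. Qed.

Lemma Des_nth n (ws : seq 'S_n) L k : map (@Des_bits n) ws = L -> k < size ws ->
  Des (nth 1%g ws k) = decode n (nth [::] L k).
Proof. by move=> <- kw; rewrite DesE (nth_map 1%g). Qed.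

Lemma singlesE m : singles m = [seq [seq j == i | j <- iota 1 m] | i <- iota 1 m].
Proof.
have shift (f : nat -> bitseq) : map f (iota 1 m) = [seq f i.+1 | i <- iota 0 m].
  by rewrite (iotaDl 1 0) -map_comp.
by rewrite shift; apply: eq_map => i; apply: singleE.
Qed.

Lemma cosinglesE m : cosingles m = [seq [seq j != i | j <- iota 1 m] | i <- iota 1 m].
Proof.
by rewrite /cosingles singlesE -map_comp; apply: eq_map => i /=; rewrite -map_comp.
Qed.

(** Taking for [g i] equality with [i] or its negation gives the two families of case (b). *)
Lemma descents_enum n (S : {set 'S_n}) (g : nat -> pred nat) :
    perm_eq (descents S) [seq map (g i) (iota 1 n.-1) | i <- iota 1 n.-1] ->
  exists f, S =i [seq f i | i <- iota 1 n.-1] /\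
    forall i, i \in iota 1 n.-1 -> Des (f i) = filter (g i) (iota 1 n.-1).
Proof.
move=> /descents_perm[ws Sws E].
have sws : size ws = n.-1 by have /(congr1 size) := E; rewrite !size_map size_iota.
have nthE k : k = size ws -> [seq nth 1%g ws i.-1 | i <- iota 1 k] = ws.
  by move=> ->; rewrite (iotaDl 1 0) -map_comp -[RHS](mkseq_nth 1%g).
exists (fun i => nth 1%g ws i.-1); split=> [|i]; first by rewrite nthE.
rewrite mem_iota => /andP[i0 im]; have {}im : i.-1 < n.-1 by lia.
rewrite (Des_nth E) ?sws // (nth_map 0) ?size_iota // nth_iota // decode_map.
by rewrite add1n prednK.
Qed.

Lemma trivial_nseq b : ~~ nontrivial b -> b = nseq (size b) false \/ b = nseq (size b) true.
Proof.
rewrite /nontrivial negb_and => /orP[] nb; [left|right];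
by apply/all_pred1P/allP => -[] // bx; rewrite bx in nb.
Qed.

(** Verbatim condition (2), so that it is convertible with the local [cond2] of the theorem. *)
Definition small_symmetric n (S : {set 'S_n}) : Prop :=
    (S \subset [set iota_perm n; delta_perm n])
    \/ (exists f : nat -> 'S_n,
          S =i [seq f i | i <- iota 1 n.-1] /\
          ((forall i, i \in iota 1 n.-1 -> Des (f i) = [:: i]) \/
           (forall i, i \in iota 1 n.-1 ->
                      Des (f i) = [seq j <- iota 1 n.-1 | j != i])))
    \/ (n = 4 /\ exists p1 p2 : 'S_n,
          Des p1 = [:: 1; 3] /\ Des p2 = [:: 2] /\
          (S =i [:: p1; p2] \/ S =i [:: p1; p2; iota_perm n] \/
           S =i [:: p1; p2; delta_perm n]))
    \/ (n = 6 /\ exists f : nat -> 'S_n,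
          S =i [seq f i | i <- iota 1 5] /\
          ((Des (f 1) = [:: 1; 3; 5] /\ Des (f 2) = [:: 2; 5] /\
            Des (f 3) = [:: 3] /\ Des (f 4) = [:: 1; 4] /\
            Des (f 5) = [:: 2; 4]) \/
           (Des (f 1) = [:: 2; 4] /\ Des (f 2) = [:: 1; 3; 4] /\
            Des (f 3) = [:: 1; 2; 4; 5] /\ Des (f 4) = [:: 2; 3; 5] /\
            Des (f 5) = [:: 1; 3; 5]))).

Lemma size_descents_lt n (S : {set 'S_n}) : #|S| + 1 <= n -> size (descents S) < n.
Proof. by rewrite size_map -cardE addn1. Qed.

Lemma schur_positive_small n (S : {set 'S_n}) : 0 < n ->
  small_symmetric S -> schur_positive (Qfun S).
Proof.
move=> n0.
move=> c2; suff : schur_positive (Fsum n (descents S)).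
  by apply: schur_positive_ext => s; rewrite QfunE.
case: c2 => [sub|[[f [Sf Df]]|[[n4 [p1 [p2 [D1 [D2 Sp]]]]]|[n6 [f [Sf Df]]]]]].
(* In case (a) every vector is constant and contributes the Schur function of a row or of a
   column. *)
- have : all (fun b => (b == nseq n.-1 false) || (b == nseq n.-1 true)) (descents S).
    apply/allP => b /mapP[w]; rewrite mem_enum => /(subsetP sub).
    by rewrite !inE => /orP[] /eqP -> ->; rewrite ?Des_bits_iota ?Des_bits_delta eqxx ?orbT.
  elim: (descents S) => [_|b M IH /andP[bE /IH]]; first exact: schur_positive_nil.
  rewrite -cat1s; apply: schur_positive_cat.
  by case/orP: bE => /eqP ->; [apply: schur_positive_zeros|apply: schur_positive_ones].
- have Du : uniq (map (@Des n) [seq f i | i <- iota 1 n.-1]).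
    rewrite -map_comp map_inj_in_uniq ?iota_uniq // => i j ii jj /=.
    case: Df => Df; rewrite !Df //; first by case.
    move=> E; apply/eqP; have := mem_filter (fun j0 => j0 != j) i (iota 1 n.-1).
    by rewrite -E mem_filter eqxx ii andbT /=; case: (i == j).
  have p := perm_descents Sf Du; rewrite perm_sym in p.
  apply: (schur_positive_perm p); rewrite -!map_comp.
  case: Df => Df.
    have -> : [seq (bits_of n \o (@Des n \o f)) i | i <- iota 1 n.-1] = singles n.-1.
      rewrite singlesE; apply/eq_in_map => i /Df /= ->.
      by apply: eq_map => j; rewrite inE.
    by rewrite -[in Fsum n](prednK n0); apply: schur_positive_singles.
  have -> : [seq (bits_of n \o (@Des n \o f)) i | i <- iota 1 n.-1] = cosingles n.-1.
    rewrite cosinglesE; apply/eq_in_map => i /Df /= ->; apply/eq_in_map => j jj.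
    by rewrite mem_filter jj andbT.
  by rewrite -[in Fsum n](prednK n0); apply: schur_positive_cosingles.
- subst n; have Di : Des (iota_perm 4) = [::] by rewrite DesE Des_bits_iota.
  have Dd : Des (delta_perm 4) = [:: 1; 2; 3] by rewrite DesE Des_bits_delta.
  case: Sp => [Sp|[Sp|Sp]].
  + have := perm_descents Sp; rewrite /= D1 D2 perm_sym => /(_ isT) p.
    exact: (schur_positive_perm p schur_positive22).
  + have := perm_descents Sp; rewrite /= D1 D2 Di perm_sym => /(_ isT) p.
    apply: (schur_positive_perm p).
    exact: (schur_positive_cat schur_positive22 (@schur_positive_zeros 4 isT)).
  + have := perm_descents Sp; rewrite /= D1 D2 Dd perm_sym => /(_ isT) p.
    apply: (schur_positive_perm p).
    exact: (schur_positive_cat schur_positive22 (@schur_positive_ones 4 isT)).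
- subst n; case: Df => -[D1 [D2 [D3 [D4 D5]]]];
    have := perm_descents Sf; rewrite /= D1 D2 D3 D4 D5 perm_sym => /(_ isT) p.
    exact: (schur_positive_perm p schur_positive33).
  exact: (schur_positive_perm p schur_positive222).
Qed.

Lemma small_symmetric_of_series n (S : {set 'S_n}) : #|S| + 1 <= n ->
  is_symmetric (Qfun S) -> small_symmetric S.
Proof.
case: n S => [|m] S; first by rewrite addn1.
move=> /size_descents_lt leM /(is_symmetric_ext (@QfunE _ S)) symQ.
have szM b : b \in descents S -> size b = m by exact: size_descents.
have sM := block_symmetric_of_series szM symQ.
set M := descents S in leM szM sM.
(* If all vectors are constant, case (a) holds, since a constant descent vector determines its
   permutation. *)
have [M0|ntM] := eqVneq (filter nontrivial M) [::].
  left; apply/subsetP => w Sw.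
  have Mw : Des_bits w \in M by apply: map_f; rewrite mem_enum.
  have : Des_bits w \notin filter nontrivial M by rewrite M0.
  rewrite mem_filter Mw andbT => /trivial_nseq; rewrite size_Des_bits !inE => -[] E.
    by rewrite (Des_bits_false_inj E (Des_bits_iota _)) eqxx.
  by rewrite (Des_bits_true_inj E (Des_bits_delta _)) eqxx orbT.
have m1 : 1 < m.
  have : has nontrivial M by rewrite has_filter.
  by case/hasP => b /szM <-; case: b => [|[] [|? ?]].
have leF : size (filter nontrivial M) <= size M by rewrite size_filter count_size.
(* If the nonconstant vectors already number [m], the bound on [S] leaves no room for constant
   ones. *)
have full L : perm_eq (filter nontrivial M) L -> size L = m -> perm_eq M L.
  move=> p sL; have /all_filterP <- // : all nontrivial M.
  rewrite all_count -size_filter eqn_leq leF /= (perm_size p) sL -ltnS; exact: leM.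
right; have : classified m (filter nontrivial M).
  apply: classification => //; rewrite ?filter_all //.
  - by move=> b; rewrite mem_filter => /andP[_ /szM].
  - by apply: block_symmetric_nontrivial => // b /szM ->.
  - by apply: leq_trans leF _; rewrite -ltnS; exact: leM.
case/or4P => [/full p|/full p|/andP[/eqP m3 p]|/andP[/eqP m5 p]].
- left; have [|f [Sf Df]] := @descents_enum _ S (fun i j => j == i).
    by rewrite -singlesE p // size_map size_iota.
  exists f; split=> //; left=> i ii.
  by rewrite Df // filter_pred1_uniq ?iota_uniq.
- left; have [|f [Sf Df]] := @descents_enum _ S (fun i j => j != i).
    by rewrite -cosinglesE p // !size_map size_iota.
  by exists f; split=> //; right.
- subst m; right; left; split=> //.
  (* As [bits22] has two vectors, at most one constant vector remains, that of [iota_perm] or of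
     [delta_perm]. *)
  have pM : perm_eq M (bits22 ++ filter (predC nontrivial) M).
    by rewrite -(perm_filterC nontrivial M) perm_cat2r.
  have [ws Sws] := descents_perm pM.
  have : size (filter (predC nontrivial) M) <= 1.
    by move: leM; rewrite (perm_size pM) size_cat.
  have : all (predC nontrivial) (filter (predC nontrivial) M) by exact: filter_all.
  case: (filter _ _) => [_ _|t [|//] /andP[tt _] _].
    case: ws Sws => [|p1 [|p2 []]] // Sws E.
    exists p1, p2; split; [exact: (Des_nth (k := 0) E)|split; [exact: (Des_nth (k := 1) E)|by left]].
  case: ws Sws => [|p1 [|p2 [|p3 []]]] // Sws E.
  exists p1, p2; split; [exact: (Des_nth (k := 0) E)|split; [exact: (Des_nth (k := 1) E)|right]].
  have E3 : Des_bits p3 = t := congr1 (nth [::]^~ 2) E.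
  have st : size t = 3 by rewrite -E3 size_Des_bits.
  have [] := trivial_nseq tt; rewrite st => tE; [left|right] => w; rewrite Sws.
    by rewrite (@Des_bits_false_inj _ p3 (iota_perm 4)) ?Des_bits_iota // E3.
  by rewrite (@Des_bits_true_inj _ p3 (delta_perm 4)) ?Des_bits_delta // E3.
subst m; right; right; split=> //; case/orP: p => /full/(_ erefl)/descents_perm[ws Sws E];
  have sws := congr1 size E; rewrite size_map in sws;
  exists (fun i => nth 1%g ws i.-1); (split; first by case: ws Sws sws {E} => [|? [|? [|? [|? [|? []]]]]]);
  [left|right]; rewrite !(Des_nth E) ?sws //.
Qed.

Theorem theorem1p3 (n : nat) (S : {set 'S_n}) :
  #|S| + 1 <= n ->
  let cond2 :=
    (* (a) *)
    (S \subset [set iota_perm n; delta_perm n])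
    (* (b) *)
    \/ (exists f : nat -> 'S_n,
          S =i [seq f i | i <- iota 1 n.-1] /\
          ((forall i, i \in iota 1 n.-1 -> Des (f i) = [:: i]) \/
           (forall i, i \in iota 1 n.-1 ->
                      Des (f i) = [seq j <- iota 1 n.-1 | j != i])))
    (* (c) *)
    \/ (n = 4 /\ exists p1 p2 : 'S_n,
          Des p1 = [:: 1; 3] /\ Des p2 = [:: 2] /\
          (S =i [:: p1; p2] \/ S =i [:: p1; p2; iota_perm n] \/
           S =i [:: p1; p2; delta_perm n]))
    (* (d) *)
    \/ (n = 6 /\ exists f : nat -> 'S_n,
          S =i [seq f i | i <- iota 1 5] /\
          ((Des (f 1) = [:: 1; 3; 5] /\ Des (f 2) = [:: 2; 5] /\
            Des (f 3) = [:: 3] /\ Des (f 4) = [:: 1; 4] /\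
            Des (f 5) = [:: 2; 4]) \/
           (Des (f 1) = [:: 2; 4] /\ Des (f 2) = [:: 1; 3; 4] /\
            Des (f 3) = [:: 1; 2; 4; 5] /\ Des (f 4) = [:: 2; 3; 5] /\
            Des (f 5) = [:: 1; 3; 5]))) in
  (is_symmetric (Qfun S) <-> cond2) /\ (cond2 <-> schur_positive (Qfun S)).
Proof.
move=> leS cond2.
have n0 : 0 < n by apply: leq_trans leS; rewrite addn1.
(* The implications run from (1) to (2) to (3), and (3) contains (1) by definition. *)
have symP : is_symmetric (Qfun S) -> cond2 := small_symmetric_of_series leS.
have cond2P : cond2 -> schur_positive (Qfun S) := @schur_positive_small n S n0.
split; split=> //; first by move=> /cond2P[].
by case=> /symP.
Qed.
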